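(* For $\sigma>0$ let $\varphi_L(t,\sigma)=\frac{\sigma^2}{\sigma^2+t^2}$, $t\in\mathbb{R}$, and let $\widetilde{\varphi}_L(t,\sigma)$ be the basic nod function of the system of integer shifts of $\varphi_L(\cdot,\sigma)$. Then, as $\sigma\to\infty$, $\widetilde{\varphi}_L(\cdot,\sigma)$ converges in $L_2(\mathbb{R})$ to the function $t\mapsto\mathrm{sinc}(\pi t)=\frac{\sin \pi t}{\pi t}$, that is, $$\lim_{\sigma\to\infty}\int_{-\infty}^{\infty}\left|\widetilde{\varphi}_L(t,\sigma)-\frac{\sin\pi t}{\pi t}\right|^2dt=0.$$
   Context: Given a function $\varphi$ on $\mathbb{R}$, the basic nod function (fundamental interpolating function) of the system of its integer shifts is the function $$\widetilde{\varphi}(t)=\sum_{k=-\infty}^{\infty}d_k\,\varphi(t-k),\qquad (d_k)_{k\in\mathbb{Z}}\in\ell_2,$$ satisfying $\widetilde{\varphi}(m)=\delta_{0m}$ for all $m\in\mathbb{Z}$, where $\delta_{0m}$ is the Kronecker symbol. Equivalently, the $d_k$ are the coefficients of the Fourier series $D(t)=\sum_k d_k e^{-ikt}$ with $D(t)\Phi(t)=1$, where $\Phi(t)=\sum_{k}\varphi(k)e^{-ikt}$. *)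

(* Defs.v *)
From HB Require Import structures.
From mathcomp Require Import all_boot all_order all_algebra.
From mathcomp Require Import all_classical all_reals all_analysis.

Set Implicit Arguments.
Unset Strict Implicit.
Unset Printing Implicit Defensive.

Import Order.TTheory GRing.Theory Num.Theory.
Import numFieldNormedType.Exports.

Local Open Scope classical_set_scope.
Local Open Scope ring_scope.

(* Convergence of a bilateral series means that its two halves, over the
   indices k >= 0 and k < 0, converge separately; [Negz n] is [- n.+1]. *)
Definition bilateral_sum (R : realType) (a : int -> R) (s : R) : Prop :=
  exists s1 s2 : R,
    [/\ series (fun n => a (Posz n)) n @[n --> \oo] --> s1,
        series (fun n => a (Negz n)) n @[n --> \oo] --> s2
      & s = s1 + s2].

Definition ell2 (R : realType) (d : int -> R) : Prop :=
  summable [set: int] (fun k => ((d k) ^+ 2)%:E).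

Definition basic_nod_function (R : realType) (phi f : R -> R) : Prop :=
  (exists2 d : int -> R,
     ell2 d & forall t, bilateral_sum (fun k => d k * phi (t - k%:~R)) (f t)) /\
  (forall m : int, f m%:~R = (m == 0)%:R).

Definition lorentz (R : realType) (s t : R) : R := s ^+ 2 / (s ^+ 2 + t ^+ 2).

Definition sinc (R : realType) (x : R) : R := if x == 0 then 1 else sin x / x.

(* Main.v *)
Require Import Defs.
From HB Require Import structures.
From mathcomp Require Import all_boot all_order all_algebra.
From mathcomp Require Import all_classical all_reals all_analysis.
From mathcomp Require Import measurable_realfun.
From mathcomp Require Import ring lra zify.

Import Order.TTheory GRing.Theory Num.Theory.
Import numFieldNormedType.Exports.

Local Open Scope classical_set_scope.
Local Open Scope ring_scope.

(** Let [phi = lorentz s].  The symbol [Phi(w)], the sum over [k] of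
    [phi(k) exp(-ikw)], is on [0, 2 pi] a multiple of [cosh (s (pi - w))],
    because the [k]-th cosine coefficient of that function is a multiple of
    [phi(k)] ([lorentz_int]).  Its inverse [D] ([inv_symbol]) is smooth inside
    the period and only has corners at the multiples of [2 pi].  Two
    integrations by parts therefore make its cosine coefficients
    [O(1 / k ^ 2)] ([cosine_coef_decay]), hence absolutely summable, and [D]
    is everywhere the sum of its cosine series ([cosine_expansion]).  These
    coefficients are the [d_k] of the nod function: their convolution with the
    samples of [phi] has [Phi D = 1] as its symbol, so it is the Kronecker
    delta ([nod_fun_int]).  An absolutely summable inverse also makes
    convolution with the samples of [phi] injective on bounded sequences
    ([lorentz_convolution_injective]); as square summable sequences are
    bounded, the nod function is unique.

    For the limit, [phi] is the Fourier transform of a two-sided exponential: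
    [phi(t)] is the integral over the line of [(s / 2) exp (- s |w|) cos (w t)]
    ([Rintegral_expR_cos]).  Integrating the series of the nod function term by
    term shows that the nod function is the cosine transform of
    [(s / 2) exp (- s |w|) D(w)], with [D] extended by periodicity
    ([nod_fun_series]), whereas [sinc (pi t)] is the cosine transform of
    [1 / (2 pi)] on [[- pi, pi]] ([sincE]).  The explicit form of [D] bounds
    the difference of these two densities by
    [exp (- s | |w| - pi |) / (2 pi)] ([spectral_error_le]): it concentrates at
    the band edges, and its squared L2 norm is [O(1 / s)].  Plancherel's
    inequality ([cos_transform_L2_le]) carries this over to the functions and
    yields a squared distance of at most [1 / s] ([nod_fun_L2_dist]).

    Plancherel's inequality is obtained by inserting the weight
    [exp (- e |t|)], which turns the left-hand side into a quadratic form with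
    a positive Poisson kernel of constant mass, and by letting [e] tend to 0.
    The cosine expansion rests on a uniqueness theorem: a continuous function
    with vanishing cosine coefficients is zero on [[0, pi]]
    ([cos_orthogonal_eq0]), since it is orthogonal to trigonometric
    polynomials that peak at an arbitrary point. *)

Set Implicit Arguments.
Unset Strict Implicit.
Unset Printing Implicit Defensive.

(** * Integrals on the line by the fundamental theorem of calculus *)

Section WholeLineIntegrals.
Context {R : realType}.
Notation mu := (@lebesgue_measure R).
Implicit Types (f F : R -> R) (a b c l t x : R).

Lemma derivable_continuous_all F f : (forall x, is_derive x 1 F (f x)) ->
  continuous F.
Proof.
by move=> dF x; apply/differentiable_continuous/derivable1_diffP; case: (dF x).
Qed.

Lemma Rintegral_FTC F f a b : a <= b -> continuous f ->
  (forall x, is_derive x 1 F (f x)) ->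
  \int[mu]_(x in `[a, b]) f x = F b - F a.
Proof.
rewrite le_eqVlt => /predU1P[->|ab] cf dF.
  by rewrite set_itv1 Rintegral_set1 subrr.
have cF := derivable_continuous_all dF.
rewrite /Rintegral (@continuous_FTC2 _ f F)//.
- exact: continuous_subspaceT.
- split; first by move=> x _; case: (dF x).
  + exact/cvg_at_right_filter/cF.
  + exact/cvg_at_left_filter/cF.
- by move=> x _; rewrite derive1E; case: (dF x).
Qed.

Lemma ge0_integral_ray_FTC F f a l : (forall x, a <= x -> 0 <= f x) ->
  continuous f -> (forall x, is_derive x 1 F (f x)) ->
  F x @[x --> +oo] --> l ->
  (\int[mu]_(x in `[a, +oo[) (f x)%:E = (l - F a)%:E)%E.
Proof.
move=> f0 cf dF Fl.
rewrite (@ge0_continuous_FTC2y _ f F a l)//.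
- exact: continuous_subspaceT.
- exact/cvg_at_right_filter/(derivable_continuous_all dF).
- by move=> x _; rewrite derive1E; case: (dF x).
Qed.

Lemma ge0_integral_line_FTC F f l1 l2 : (forall x, 0 <= f x) ->
  continuous f -> (forall x, is_derive x 1 F (f x)) ->
  F x @[x --> -oo] --> l1 -> F x @[x --> +oo] --> l2 ->
  (\int[mu]_x (f x)%:E = (l2 - l1)%:E)%E.
Proof.
move=> f0 cf dF Fl1 Fl2.
have mf (D : set (measurableTypeR R)) : measurable_fun D (fun x => (f x)%:E).
  apply/measurable_EFinP; apply: measurable_funTS.
  exact: continuous_measurable_fun.
have setTE : [set: R] = `]-oo, 0[ `|` `[0, +oo[.
  by rewrite -(setUv `[0, +oo[) setCitvr setUC.
rewrite setTE ge0_integral_setU//=; last 2 first.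
- by move=> x _; rewrite lee_fin.
- by rewrite disj_set_sym -setCitvr; exact/disj_setPCl.
rewrite integral_itv_bndo_bndc//.
rewrite -[X in `]-oo, X]]oppr0 ge0_integration_by_substitutionNy//; last 1 first.
- exact: continuous_subspaceT.
rewrite (@ge0_integral_ray_FTC F f 0 l2)//.
have dFN x : is_derive x 1 (fun x => - F (- x)) ((f \o -%R) x).
  have dFx := dF (- x).
  apply: is_derive_eq; rewrite /GRing.scale/=; ring.
rewrite (@ge0_integral_ray_FTC _ _ 0 (- l1) _ _ dFN)//=.
- by rewrite oppr0 -EFinD; congr EFin; ring.
- by move=> x; apply: continuous_comp; [exact: opp_continuous|exact: cf].
- by apply: cvgN; exact/cvgNy_compNP.
- exact: mf.
Qed.

Lemma cvgy_affine (a c : R) : 0 < a -> (c + x) / a @[x --> +oo] --> +oo.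
Proof.
move=> a0; apply/cvgryPge => A; near=> x.
rewrite ler_pdivlMr// -lerBlDl; near: x. apply: nbhs_pinfty_ge; exact: num_real.
Unshelve. all: by end_near. Qed.

(** The mass of the Poisson kernel.  The shift [c] is there because Plancherel's
    inequality meets the kernel at [w - v] and at [w + v]. *)
Lemma ge0_integral_poisson (a c : R) : 0 < a ->
  (\int[mu]_y (a / (a ^+ 2 + (c + y) ^+ 2))%:E = (pi : R)%:E)%E.
Proof.
move=> a0; have a2 y : a ^+ 2 + (c + y) ^+ 2 != 0.
  by rewrite gt_eqF// ltr_wpDr ?sqr_ge0 ?exprn_gt0.
have cvgF d : atan ((d + x) / a) @[x --> +oo] --> (pi / 2 : R).
  by have := @cvg_comp _ _ _ (fun x : R => (d + x) / a) (@atan R) _ _ _ (cvgy_affine d a0) (@cvgy_atan R).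
have dF x : is_derive x 1 (fun y => atan ((c + y) / a))
    (a / (a ^+ 2 + (c + x) ^+ 2)).
  have d1 : is_derive x 1 (fun y => (c + y) / a) a^-1.
    by apply: is_derive_eq; rewrite /GRing.scale/= ; ring.
  have := @is_derive1_comp _ atan (fun y => (c + y) / a) _ _ _ (is_derive1_atan ((c + x) / a)) d1.
  rewrite (_ : _ * _ = a / (a ^+ 2 + (c + x) ^+ 2))//.
  have : 1 + ((c + x) / a) ^+ 2 != 0.
    by rewrite gt_eqF// ltr_wpDr ?sqr_ge0.
  move: (a2 x) => h1 h2; field.
  by rewrite h1 gt_eqF.
rewrite (@ge0_integral_line_FTC _ _ (- (pi / 2)) (pi / 2) _ _ dF).
- by congr EFin; lra.
- by move=> x; rewrite divr_ge0 ?addr_ge0 ?sqr_ge0 // ltW.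
- move=> x; apply: cvgM; first exact: cvg_cst.
  apply: cvgV; first exact: a2.
  apply: cvgD; first exact: cvg_cst.
  have cx : (c + y) @[y --> x] --> c + x by apply: cvgD; [exact: cvg_cst|].
  exact: (cvgM cx cx).
- apply/cvgNy_compNP.
  have -> : (fun y => atan ((c + y) / a)) \o -%R = fun y => - atan ((- c + y) / a).
    by apply/funext => y /=; rewrite -atanN; congr atan; ring.
  exact: cvgN.
- exact: cvgF.
Qed.

End WholeLineIntegrals.

(** * The cosine transform of the two-sided exponential *)

Section ExpCos.
Context {R : realType}.
Notation mu := (@lebesgue_measure R).
Implicit Types (a t x : R).

Lemma continuous_expRN_norm a : continuous (fun x : R => expR (- (a * `|x|))).
Proof.
move=> x; apply: (@continuous_comp _ _ _ (fun x : R => - (a * `|x|)) expR);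
  last exact: continuous_expR.
by apply: cvgN; apply: cvgM; [exact: cvg_cst|exact: norm_continuous].
Qed.

Lemma continuous_cosM t : continuous (fun x : R => cos (x * t)).
Proof.
move=> x; apply: (@continuous_comp _ _ _ (fun x : R => x * t) cos);
  last exact: continuous_cos.
exact: mulrr_continuous.
Qed.

Lemma cvgy_expRN_mul_bounded a (g : R -> R) (M : R) : 0 < a ->
  (forall x, `|g x| <= M) -> expR (- (a * x)) * g x @[x --> +oo] --> (0 : R).
Proof.
move=> a0 gM; apply/cvgrPdist_lt => e e0.
have M0 : 0 <= M by apply: le_trans (gM 0).
near=> x; rewrite sub0r normrN normrM ger0_norm ?expR_ge0//.
have x0 : 0 < x by near: x; apply: nbhs_pinfty_gt; exact: num_real.
have ax : 0 < a * x by rewrite mulr_gt0.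
apply: (@le_lt_trans _ _ ((a * x)^-1 * M)).
  apply: ler_pM => //; rewrite ?expR_ge0//.
  rewrite expRN lef_pV2 ?posrE ?expR_gt0//.
  by apply: le_trans (expR_ge1Dx _); rewrite lerDr.
rewrite mulrC ltr_pdivrMr// mulrC -ltr_pdivrMr// -ltr_pdivrMl//.
near: x; apply: nbhs_pinfty_gt; exact: num_real.
Unshelve. all: by end_near. Qed.

(** The factor [1 + cos (x * t)], in place of [cos (x * t)], keeps the integrand
    nonnegative, which is what the fundamental theorem on a half-line needs; the
    case [t = 0] then isolates the cosine. *)
Lemma ge0_integral_expR_cos a t : 0 < a ->
  (\int[mu]_x (expR (- (a * `|x|)) * (1 + cos (x * t)))%:E =
   (2 / a + 2 * a / (a ^+ 2 + t ^+ 2))%:E)%E.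
Proof.
move=> a0; have c1 x : 0 <= 1 + cos (x * t).
  by have := cos_geN1 (x * t); lra.
have at0 : a ^+ 2 + t ^+ 2 != 0.
  by rewrite gt_eqF// ltr_wpDr ?sqr_ge0 ?exprn_gt0.
have cc : continuous (fun x => 1 + cos (x * t)).
  by move=> x; apply: cvgD; [exact: cvg_cst|exact: continuous_cosM].
rewrite ge0_symfun_integralT; last 3 first.
- by move=> x; rewrite mulr_ge0 ?expR_ge0.
- move=> x; apply: cvgM; [exact: continuous_expRN_norm|exact: cc].
- by move=> x /=; rewrite normrN mulNr cosN.
rewrite -set_itvcy (eq_integral (fun x : measurableTypeR R =>
  (expR (- (a * x)) * (1 + cos (x * t)))%:E)); last first.
  by move=> x; rewrite inE/= in_itv/= andbT => x0; rewrite ger0_norm.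
pose F x := expR (- (a * x)) *
  (- a^-1 + (t * sin (x * t) - a * cos (x * t)) / (a ^+ 2 + t ^+ 2)).
have dF x : is_derive x 1 F (expR (- (a * x)) * (1 + cos (x * t))).
  rewrite /F; apply: is_derive_eq; rewrite /GRing.scale/=.
  by field; rewrite at0 gt_eqF.
rewrite (@ge0_integral_ray_FTC _ F _ 0 0)//.
- rewrite -EFinM; congr EFin; rewrite /F mulr0 oppr0 expR0 mul0r sin0 cos0.
  by field; rewrite at0 gt_eqF.
- move=> x; apply: cvgM; last exact: cc.
  apply: (@continuous_comp _ _ _ (fun x : R => - (a * x)) expR);
    last exact: continuous_expR.
  by apply: cvgN; exact: mulrl_continuous.
- apply: (@cvgy_expRN_mul_bounded _ _
    (a^-1 + (`|t| + a) / (a ^+ 2 + t ^+ 2))) => // x.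
  apply: le_trans (ler_normD _ _) _; apply: lerD.
    by rewrite normrN ger0_norm// invr_ge0 ltW.
  rewrite normrM [X in _ * X]ger0_norm; last first.
    by rewrite invr_ge0 addr_ge0 ?sqr_ge0.
  rewrite ler_wpM2r// ?invr_ge0 ?addr_ge0 ?sqr_ge0//.
  apply: le_trans (ler_normB _ _) _; rewrite !normrM (gtr0_norm a0).
  apply: lerD; last by rewrite ger_pMr ?cos_max.
  by rewrite ler_piMr ?sin_max.
Qed.

Lemma le_integrable_real (D : set (measurableTypeR R)) (f g : R -> R) :
  measurable D -> measurable_fun D f -> mu.-integrable D (EFin \o g) ->
  (forall x, D x -> `|f x| <= g x) -> mu.-integrable D (EFin \o f).
Proof.
move=> mD mf ig fg; apply: le_integrable ig => //.
- exact/measurable_EFinP.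
- by move=> x Dx /=; rewrite lee_fin (le_trans (fg x Dx))// ler_norm.
Qed.

Lemma integrable_mul_bounded (D : set (measurableTypeR R)) (f g : R -> R) M :
  measurable D -> mu.-integrable D (EFin \o f) -> measurable_fun D g ->
  (forall x, D x -> `|g x| <= M) ->
  mu.-integrable D (EFin \o (fun x => f x * g x)).
Proof.
move=> mD intf mg gM.
have mf : measurable_fun D f.
  by apply/measurable_EFinP; exact: measurable_int intf.
apply: (@le_integrable_real _ _ (fun x => M * `|f x|)) => //.
- exact: measurable_funM.
- have := integrableZl mD M (integrable_abse intf).
  by apply: eq_integrable => // x _; rewrite /= EFinM.
- by move=> x Dx; rewrite normrM mulrC ler_wpM2r// gM.
Qed.

Lemma integrable_expR_cos1 a t : 0 < a -> mu.-integrable setT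
  (EFin \o (fun x : R => expR (- (a * `|x|)) * (1 + cos (x * t)))).
Proof.
move=> a0; apply/integrableP; split.
  apply/measurable_EFinP; apply: continuous_measurable_fun => x.
  apply: cvgM; first exact: continuous_expRN_norm.
  by apply: cvgD; [exact: cvg_cst|exact: continuous_cosM].
under eq_integral.
  move=> x _; rewrite /= ger0_norm; last first.
    by have := cos_geN1 (x * t); rewrite mulr_ge0 ?expR_ge0//; lra.
  over.
by rewrite ge0_integral_expR_cos// ltry.
Qed.

Lemma integrable_expRN_norm a : 0 < a ->
  mu.-integrable setT (EFin \o (fun x : R => expR (- (a * `|x|)))).
Proof.
move=> a0; apply: le_integrable_real (integrable_expR_cos1 0 a0) _ => //.
  by apply: continuous_measurable_fun; exact: continuous_expRN_norm.
move=> x _; rewrite mulr0 cos0 ger0_norm ?expR_ge0//.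
by rewrite ler_peMr ?expR_ge0// lerDl.
Qed.

Lemma Rintegral_expR_cos a t : 0 < a ->
  \int[mu]_x (expR (- (a * `|x|)) * cos (x * t)) = 2 * a / (a ^+ 2 + t ^+ 2).
Proof.
move=> a0; have ie := integrable_expRN_norm a0.
have H s : \int[mu]_x (expR (- (a * `|x|)) * (1 + cos (x * s))) =
    \int[mu]_x (expR (- (a * `|x|))) +
    \int[mu]_x (expR (- (a * `|x|)) * cos (x * s)).
  rewrite -RintegralD//; first by apply: eq_Rintegral => x _; ring.
  apply: (@integrable_mul_bounded _ _ _ 1) => //.
    by apply: measurable_funTS; apply: continuous_measurable_fun; exact: continuous_cosM.
  by move=> x _; exact: cos_max.
have V s : \int[mu]_x (expR (- (a * `|x|)) * (1 + cos (x * s))) =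
    2 / a + 2 * a / (a ^+ 2 + s ^+ 2).
  by rewrite /Rintegral ge0_integral_expR_cos.
have e0 : \int[mu]_x (expR (- (a * `|x|))) = 2 / a.
  have E0 : \int[mu]_x (expR (- (a * `|x|)) * cos (x * 0)) =
      \int[mu]_x (expR (- (a * `|x|))).
    by apply: eq_Rintegral => x _; rewrite mulr0 cos0 mulr1.
  have := H 0; rewrite V E0 => e.
  have {e} : 2 / a + 2 * a / (a ^+ 2 + 0 ^+ 2) =
    2 * \int[mu]_x (expR (- (a * `|x|))) by rewrite e; ring.
  rewrite (_ : 2 / a + _ = 2 * (2 / a)); last by field; rewrite gt_eqF.
  by move/mulfI => ->.
by have := H t; rewrite V e0 => /addrI.
Qed.

End ExpCos.

(** * Fubini for real-valued integrals *)

Section FubiniReal.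
Context {R : realType}.
Notation mu := (@lebesgue_measure R).
Implicit Types (u v h : R -> R) (c : R * R -> R).

(** Integrands of the form [u x * v y * c (x, y)] with [c] bounded cover the
    signed double integrals below: [u] and [v] decay, and [c] is an oscillating cosine. *)
Lemma integrable_prod u v c :
  mu.-integrable setT (EFin \o u) -> mu.-integrable setT (EFin \o v) ->
  measurable_fun [set: measurableTypeR R * measurableTypeR R] c ->
  (forall z, `|c z| <= 1) ->
  (mu \x mu)%E.-integrable setT (EFin \o (fun z => u z.1 * v z.2 * c z)).
Proof.
move=> iu iv mc c1.
have mu_ : measurable_fun [set: measurableTypeR R] u.
  by apply/measurable_EFinP; exact: measurable_int iu.
have mv : measurable_fun [set: measurableTypeR R] v.
  by apply/measurable_EFinP; exact: measurable_int iv.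
have mf : measurable_fun [set: measurableTypeR R * measurableTypeR R]
    (EFin \o (fun z => u z.1 * v z.2 * c z)).
  apply/measurable_EFinP; apply: measurable_funM => //.
  by apply: measurable_funM; [exact: measurableT_comp mu_ measurable_fst|
    exact: measurableT_comp mv measurable_snd].
apply/(integrable12ltyP mu mu mf).
apply: (@le_lt_trans _ _ (\int[mu]_x (`|u x|%:E * \int[mu]_y `|v y|%:E))%E).
  apply: ge0_le_integral => //.
  - by move=> x _; exact: integral_ge0.
  - have := @measurable_fun_fubini_tonelli_F _ _ _ _ _ mu
      (abse \o (EFin \o (fun z : measurableTypeR R * measurableTypeR R =>
         u z.1 * v z.2 * c z))).
    apply; first by apply: measurableT_comp => //; exact: mf.
    by move=> x; exact: abse_ge0.
  - apply: emeasurable_funM => //; apply/measurable_EFinP.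
    exact: measurableT_comp.
  - move=> x _; rewrite -ge0_integralZl//.
    + apply: ge0_le_integral => //.
      * apply: measurableT_comp => //.
        by apply: (measurableT_comp mf); exact: pair1_measurable.
      * apply/measurable_EFinP; apply: measurable_funM => //.
        exact: measurableT_comp.
      * move=> y _ /=; rewrite -EFinM lee_fin !normrM ler_piMr// mulr_ge0//.
    + by apply/measurable_EFinP; exact: measurableT_comp.
have -> : (fun x => `|u x|%:E * \int[mu]_y `|v y|%:E)%E =
    (fun x => \int[mu]_y `|v y|%:E * `|u x|%:E)%E.
  by apply/funext => x; rewrite muleC.
have iV : (\int[mu]_y `|v y|%:E < +oo)%E by case/integrableP: iv.
have iU : (\int[mu]_y `|u y|%:E < +oo)%E by case/integrableP: iu.
rewrite ge0_integralZl//.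
- by rewrite lte_mul_pinfty// ?integral_ge0// ge0_fin_numE// integral_ge0.
- by apply/measurable_EFinP; exact: measurableT_comp.
- exact: integral_ge0.
Qed.

Lemma EFin_Rintegral (D : set (measurableTypeR R)) u :
  measurable D -> mu.-integrable D (EFin \o u) ->
  (\int[mu]_(x in D) (u x)%:E = (\int[mu]_(x in D) u x)%R%:E)%E.
Proof. by move=> mD iu; rewrite /Rintegral fineK//; exact: integrable_fin_num. Qed.

Lemma Rintegral_prod1 u v c (x : R) :
  mu.-integrable setT (EFin \o v) ->
  measurable_fun [set: measurableTypeR R * measurableTypeR R] c ->
  (forall z, `|c z| <= 1) ->
  (\int[mu]_y (u x * v y * c (x, y))%:E =
   (u x * \int[mu]_y (v y * c (x, y)))%R%:E)%E.
Proof.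
move=> iv mc c1.
have ivc : mu.-integrable setT (EFin \o (fun y => v y * c (x, y))).
  apply: (@integrable_mul_bounded _ _ _ _ 1) => //.
  exact: (measurableT_comp mc (pair1_measurable x)).
rewrite EFinM -EFin_Rintegral// -integralZl//.
by apply: eq_integral => y _; rewrite -EFinM mulrA.
Qed.

Lemma Rintegral_prod2 u v c (y : R) :
  mu.-integrable setT (EFin \o u) ->
  measurable_fun [set: measurableTypeR R * measurableTypeR R] c ->
  (forall z, `|c z| <= 1) ->
  (\int[mu]_x (u x * v y * c (x, y))%:E =
   (v y * \int[mu]_x (u x * c (x, y)))%R%:E)%E.
Proof.
move=> iu mc c1.
have iuc : mu.-integrable setT (EFin \o (fun x => u x * c (x, y))).
  apply: (@integrable_mul_bounded _ _ _ _ 1) => //.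
  exact: (measurableT_comp mc (pair2_measurable y)).
rewrite EFinM -EFin_Rintegral// -integralZl//.
by apply: eq_integral => x _; rewrite -EFinM mulrCA mulrA.
Qed.

Lemma integrable_Rfubini u v c :
  mu.-integrable setT (EFin \o u) -> mu.-integrable setT (EFin \o v) ->
  measurable_fun [set: measurableTypeR R * measurableTypeR R] c ->
  (forall z, `|c z| <= 1) ->
  mu.-integrable setT (EFin \o (fun x => u x * \int[mu]_y (v y * c (x, y)))).
Proof.
move=> iu iv mc c1; have := integrable_fubini_F (integrable_prod iu iv mc c1).
by apply: eq_integrable => // x _; rewrite /fubini_F/= -Rintegral_prod1.
Qed.

Lemma Rfubini u v c :
  mu.-integrable setT (EFin \o u) -> mu.-integrable setT (EFin \o v) ->
  measurable_fun [set: measurableTypeR R * measurableTypeR R] c ->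
  (forall z, `|c z| <= 1) ->
  \int[mu]_x (u x * \int[mu]_y (v y * c (x, y))) =
  \int[mu]_y (v y * \int[mu]_x (u x * c (x, y))).
Proof.
move=> iu iv mc c1; have := Fubini (integrable_prod iu iv mc c1).
under eq_integral do rewrite /= Rintegral_prod1//.
under [X in _ = X -> _]eq_integral do rewrite /= Rintegral_prod2//.
by rewrite /Rintegral => ->.
Qed.

End FubiniReal.

(** * A Plancherel inequality *)

Section Plancherel.
Context {R : realType}.
Notation mu := (@lebesgue_measure R).
Variable h : R -> R.
Hypothesis ih : mu.-integrable setT (EFin \o h).

(** For a real even [h] this is its Fourier transform. *)
Definition cos_transform (t : R) : R := \int[mu]_w (h w * cos (w * t)).
Local Notation H := cos_transform.

Let mh : measurable_fun [set: measurableTypeR R] h.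
Proof. by apply/measurable_EFinP; exact: measurable_int ih. Qed.

Let mcosM : measurable_fun [set: measurableTypeR R * measurableTypeR R]
  (fun z : R * R => cos (z.1 * z.2)).
Proof.
have mcos : measurable_fun [set: measurableTypeR R] (@cos R).
  by apply: continuous_measurable_fun; exact: continuous_cos.
apply: (measurableT_comp mcos).
by apply: measurable_funM; [exact: measurable_fst|exact: measurable_snd].
Qed.

Let cos_le z : `|(fun z : R * R => cos (z.1 * z.2)) z| <= 1.
Proof. exact: cos_max. Qed.

Let weight (e t : R) := expR (- (e * `|t|)).

Let iweight e : 0 < e -> mu.-integrable setT (EFin \o weight e).
Proof. exact: integrable_expRN_norm. Qed.

Lemma cos_transformC t : H t = \int[mu]_w (h w * cos (t * w)).
Proof. by apply: eq_Rintegral => w _; rewrite [w * t]mulrC. Qed.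

Lemma integrable_weight_cos_transform e : 0 < e ->
  mu.-integrable setT (EFin \o (fun t => weight e t * H t)).
Proof.
move=> e0; have := integrable_Rfubini (iweight e0) ih mcosM cos_le.
by apply: eq_integrable => // t _ /=; rewrite cos_transformC.
Qed.

(** Fubini gives the measurability of the weighted transform; dividing by the
    positive weight removes it. *)
Lemma measurable_cos_transform : measurable_fun [set: measurableTypeR R] H.
Proof.
have mf : measurable_fun [set: measurableTypeR R] (fun t => weight 1 t * H t).
  apply/measurable_EFinP.
  exact: measurable_int (integrable_weight_cos_transform ltr01).
have mg : measurable_fun [set: measurableTypeR R] (fun t : R => expR (1 * `|t|)).
  by apply: measurableT_comp => //; exact: measurable_funM.
have := measurable_funM mf mg; rewrite (_ : _ \* _ = H)//.
by apply/funext => t /=; rewrite /weight expRN mulrAC mulVf ?mul1r// gt_eqF ?expR_gt0.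
Qed.

Lemma cos_transform_bounded t : `|H t| <= \int[mu]_w `|h w|.
Proof.
have i1 : mu.-integrable setT (EFin \o (fun w => h w * cos (w * t))).
  apply: (@integrable_mul_bounded _ _ _ _ 1) => //; last by move=> x _; exact: cos_max.
  by apply: continuous_measurable_fun; exact: continuous_cosM.
apply: (le_trans (le_normr_Rintegral _ i1)) => //.
apply: le_Rintegral => //.
- exact: integrable_abse i1.
- exact: integrable_abse ih.
- by move=> x _; rewrite normrM ler_piMr// cos_max.
Qed.

Let P (e x : R) := e / (e ^+ 2 + x ^+ 2).
Let k e w v := P e (w - v) + P e (w + v).

Let P_ge0 e x : 0 < e -> 0 <= P e x.
Proof. by move=> e0; rewrite divr_ge0 ?ltW// ltr_wpDr ?sqr_ge0 ?exprn_gt0. Qed.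

Let mP e : 0 < e -> measurable_fun [set: measurableTypeR R] (P e).
Proof.
move=> e0; apply: continuous_measurable_fun => x.
apply: cvgM; first exact: cvg_cst.
apply: cvgV; first by rewrite gt_eqF// ltr_wpDr ?sqr_ge0 ?exprn_gt0.
by apply: cvgD; [exact: cvg_cst|exact: exprn_continuous].
Qed.

Let mk e : 0 < e -> measurable_fun [set: measurableTypeR R * measurableTypeR R]
  (fun z : R * R => k e z.1 z.2).
Proof.
move=> e0; apply: measurable_funD; apply: (measurableT_comp (mP e0)).
- by apply: measurable_funB; [exact: measurable_fst|exact: measurable_snd].
- by apply: measurable_funD; [exact: measurable_fst|exact: measurable_snd].
Qed.

(** The Poisson kernel appears here: a product of two cosines is half the sum of
    the cosines of the difference and of the sum of the frequencies. *)
Lemma Rintegral_weight_cos_cos e w v : 0 < e ->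
  \int[mu]_t (weight e t * cos (w * t) * cos (t * v)) = k e w v.
Proof.
move=> e0.
have E t : weight e t * cos (w * t) * cos (t * v) =
    2^-1 * (weight e t * cos (t * (w - v)) + weight e t * cos (t * (w + v))).
  by rewrite (mulrBr t) (mulrDr t w) cosB cosD (mulrC w t); field.
transitivity (\int[mu]_t (2^-1 *
    (weight e t * cos (t * (w - v)) + weight e t * cos (t * (w + v))))).
  by apply: eq_Rintegral => t _; exact: E.
have I s : mu.-integrable setT (EFin \o (fun t => weight e t * cos (t * s))).
  apply: (@integrable_mul_bounded _ _ _ _ 1 _ (iweight e0)) => //; last first.
    by move=> x _; exact: cos_max.
  by apply: continuous_measurable_fun; exact: continuous_cosM.
rewrite RintegralZl//; last exact: (integrableD _ (I (w - v)) (I (w + v))).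
rewrite RintegralD// !Rintegral_expR_cos// /k /P.
field.
by rewrite !gt_eqF// ltr_wpDr ?sqr_ge0 ?exprn_gt0.
Qed.

Lemma Rintegral_kernelE e w : 0 < e ->
  \int[mu]_v (h v * k e w v) = \int[mu]_t (weight e t * H t * cos (w * t)).
Proof.
move=> e0; apply/esym.
have iwc : mu.-integrable setT (EFin \o (fun t => weight e t * cos (w * t))).
  apply: (@integrable_mul_bounded _ _ _ _ 1 _ (iweight e0)) => //; last first.
    by move=> x _; exact: cos_max.
  apply: continuous_measurable_fun; under eq_fun do rewrite mulrC.
  exact: continuous_cosM.
transitivity (\int[mu]_t (weight e t * cos (w * t) * \int[mu]_v (h v * cos (t * v)))).
  by apply: eq_Rintegral => t _; rewrite -cos_transformC mulrAC.
have := Rfubini iwc ih mcosM cos_le.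
move=> ->; apply: eq_Rintegral => v _; congr (_ * _).
by rewrite Rintegral_weight_cos_cos.
Qed.

(** Expanding both transforms and integrating in [t] first turns the weighted
    square into a quadratic form in [h]. *)
Lemma Rintegral_weight_sqr_cos_transform e : 0 < e ->
  \int[mu]_t (weight e t * H t * H t) =
  \int[mu]_w (h w * \int[mu]_v (h v * k e w v)).
Proof.
move=> e0.
transitivity (\int[mu]_t (weight e t * H t * \int[mu]_w (h w * cos (t * w)))).
  by apply: eq_Rintegral => t _; rewrite -cos_transformC.
rewrite (Rfubini (integrable_weight_cos_transform e0) ih mcosM cos_le).
apply: eq_Rintegral => w _; congr (_ * _).
rewrite Rintegral_kernelE//.
by apply: eq_Rintegral => t _ /=; rewrite [t * w]mulrC.
Qed.

(** When the integral is infinite, the real-valued one is 0. *)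
Lemma le_EFin_norm_Rintegral (f : R -> R) :
  measurable_fun [set: measurableTypeR R] f ->
  (`|\int[mu]_x f x|%:E <= \int[mu]_x `|f x|%:E)%E.
Proof.
move=> mf; have mEf : measurable_fun [set: measurableTypeR R] (EFin \o f).
  exact/measurable_EFinP.
apply: le_trans (le_abse_integral mu measurableT mEf).
by rewrite /Rintegral; case: (integral _ _ _) => //= ; rewrite normr0 leey.
Qed.

Lemma integral_kernel e w : 0 < e ->
  (\int[mu]_v (k e w v)%:E = (2 * pi)%:E)%E.
Proof.
move=> e0; under eq_integral do rewrite EFinD.
have mPc c : measurable_fun [set: measurableTypeR R] (fun v => (P e (c + v))%:E).
  apply/measurable_EFinP; apply: (measurableT_comp (mP e0)).
  exact: measurable_funD.
have PN v : P e (w - v) = P e (- w + v) by rewrite /P; congr (_ / (_ + _)); ring.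
under eq_integral do rewrite PN.
rewrite ge0_integralD//; last 2 first.
- by move=> v _; rewrite lee_fin P_ge0.
- by move=> v _; rewrite lee_fin P_ge0.
by rewrite !ge0_integral_poisson// -EFinD; congr EFin; ring.
Qed.

(** By [h w * h v <= (h w ^+ 2 + h v ^+ 2) / 2] and the symmetry of the kernel,
    the quadratic form is at most the integral of [h ^+ 2] times the mass
    [2 * pi] of the kernel, whatever the value of [e]. *)
Lemma integral_weight_sqr_cos_transform_le e : 0 < e ->
  (\int[mu]_t (weight e t * H t * H t)%:E <=
   (2 * pi)%:E * \int[mu]_w (h w ^+ 2)%:E)%E.
Proof.
move=> e0.
pose g w v := h w ^+ 2 / 2 * k e w v.
have k0 w v : 0 <= k e w v by rewrite addr_ge0// P_ge0.
have g0 w v : 0 <= g w v by rewrite mulr_ge0// divr_ge0// sqr_ge0.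
have mg : measurable_fun [set: measurableTypeR R * measurableTypeR R]
    (fun z : R * R => (g z.1 z.2)%:E).
  apply/measurable_EFinP; apply: measurable_funM; last exact: mk.
  apply: measurable_funM => //; apply: measurable_funX.
  exact: measurableT_comp mh measurable_fst.
have mgs : measurable_fun [set: measurableTypeR R * measurableTypeR R]
    (fun z : R * R => (g z.2 z.1)%:E).
  have := measurableT_comp mg (@measurable_swap _ _ (measurableTypeR R) (measurableTypeR R)).
  exact.
have mgF : measurable_fun [set: measurableTypeR R] (fun w => \int[mu]_v (g w v)%:E)%E.
  by apply: (measurable_fun_fubini_tonelli_F (m2 := mu) _ mg) => z; rewrite lee_fin.
have mgsF : measurable_fun [set: measurableTypeR R] (fun w => \int[mu]_v (g v w)%:E)%E.
  by apply: (measurable_fun_fubini_tonelli_F (m2 := mu) _ mgs) => z; rewrite lee_fin.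
have ig w : (\int[mu]_v (g w v)%:E = (pi * h w ^+ 2)%:E)%E.
  under eq_integral do rewrite EFinM.
  rewrite ge0_integralZl_EFin//.
  - by rewrite integral_kernel// -EFinM; congr EFin; field.
  - by move=> v _; rewrite lee_fin.
  - by apply/measurable_EFinP; exact: (measurableT_comp (mk e0) (pair1_measurable w)).
  - by rewrite divr_ge0// sqr_ge0.
rewrite EFin_Rintegral//; last first.
  apply: (@integrable_mul_bounded _ _ _ _ (\int[mu]_w `|h w|)) => //.
  - exact: integrable_weight_cos_transform.
  - exact: measurable_cos_transform.
  - by move=> t _; exact: cos_transform_bounded.
rewrite Rintegral_weight_sqr_cos_transform//.
pose K w := \int[mu]_v (h v * k e w v).
have mhK : measurable_fun [set: measurableTypeR R] (fun w => h w * K w).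
  apply/measurable_EFinP.
  have := measurable_int _ (integrable_Rfubini ih
    (integrable_weight_cos_transform e0) mcosM cos_le).
  congr (measurable_fun _ _); apply/funext => w /=.
  by rewrite /K Rintegral_kernelE.
apply: (@le_trans _ _ (`|\int[mu]_w (h w * K w)|%:E)).
  by rewrite lee_fin ler_norm.
apply: (le_trans (le_EFin_norm_Rintegral mhK)).
apply: (@le_trans _ _ (\int[mu]_w (\int[mu]_v (g w v)%:E + \int[mu]_v (g v w)%:E))%E).
  apply: ge0_le_integral => //.
  - by apply/measurable_EFinP; exact: measurableT_comp.
  - apply: emeasurable_funD.
    + exact: mgF.
    + exact: mgsF.
  - move=> w _; rewrite -ge0_integralD//.
    + have mhk : measurable_fun [set: measurableTypeR R] (fun v => h v * k e w v).
        apply: measurable_funM => //.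
        exact: (measurableT_comp (mk e0) (pair1_measurable w)).
      rewrite normrM EFinM.
      apply: (le_trans (lee_wpmul2l _ (le_EFin_norm_Rintegral mhk))) => //.
      rewrite -ge0_integralZl_EFin//; last first.
        by apply/measurable_EFinP; exact: measurableT_comp.
      apply: ge0_le_integral => //.
      * apply: emeasurable_funM => //; apply/measurable_EFinP.
        exact: measurableT_comp.
      * apply: emeasurable_funD.
          exact: (measurableT_comp mg (pair1_measurable w)).
        exact: (measurableT_comp mgs (pair1_measurable w)).
      * move=> v _; rewrite -EFinM -EFinD lee_fin /g.
        have -> : k e v w = k e w v.
          by rewrite /k /P; congr (_ / (_ + _) + _ / (_ + _)); ring.
        rewrite -mulrDl normrM (ger0_norm (k0 w v)) mulrA ler_wpM2r//.
        rewrite -(real_normK (num_real (h w))) -(real_normK (num_real (h v))).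
        have := sqr_ge0 (`|h w| - `|h v|); set a := `|h w|; set b := `|h v|.
        rewrite -mulrDl ler_pdivlMr// sqrrB => ?; lra.
    + by move=> v _; rewrite lee_fin.
    + exact: (measurableT_comp mg (pair1_measurable w)).
    + by move=> v _; rewrite lee_fin.
    + exact: (measurableT_comp mgs (pair1_measurable w)).
rewrite ge0_integralD//; last 2 first.
- by move=> w _; apply: integral_ge0 => v _; rewrite lee_fin.
- by move=> w _; apply: integral_ge0 => v _; rewrite lee_fin.
have -> : (\int[mu]_w \int[mu]_v (g v w)%:E = \int[mu]_w \int[mu]_v (g w v)%:E)%E.
  by apply: (fubini_tonelli (m1 := mu) (m2 := mu) _ mgs) => z; rewrite lee_fin.
under eq_integral do rewrite ig EFinM.
have m2 : measurable_fun [set: measurableTypeR R] (fun w => (h w ^+ 2)%:E).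
  by apply/measurable_EFinP; exact: measurable_funX.
rewrite ge0_integralZl_EFin ?pi_ge0//.
- by rewrite -ge0_muleDl ?lee_fin ?pi_ge0// -EFinD mulr_natl mulr2n.
- by move=> w _; rewrite lee_fin sqr_ge0.
Qed.

(** The weights increase to 1 as [e] decreases to 0, so monotone convergence
    removes them from the previous bound.  The constant is that of Plancherel's
    identity for even [h]. *)
Theorem cos_transform_L2_le :
  (\int[mu]_t (H t ^+ 2)%:E <= (2 * pi)%:E * \int[mu]_w (h w ^+ 2)%:E)%E.
Proof.
pose f n t := (weight n.+1%:R^-1 t * H t * H t)%:E.
have mH := measurable_cos_transform.
have mf n : measurable_fun [set: measurableTypeR R] (f n).
  apply/measurable_EFinP; apply: measurable_funM => //.
  apply: measurable_funM => //; apply: continuous_measurable_fun.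
  exact: continuous_expRN_norm.
have f0 n t : (0 <= f n t)%E.
  by rewrite lee_fin -mulrA -expr2 mulr_ge0 ?expR_ge0 ?sqr_ge0.
have ndf t : {homo f ^~ t : n m / (n <= m)%N >-> (n <= m)%E}.
  move=> n m nm; rewrite lee_fin -!mulrA -expr2 ler_wpM2r ?sqr_ge0//.
  rewrite ler_expR lerN2 ler_wpM2r// lef_pV2 ?posrE// ler_nat//.
have cf t : f n t @[n --> \oo] --> (H t ^+ 2)%:E.
  apply: cvg_EFin; first exact: nearW.
  have w1 : weight n.+1%:R^-1 t @[n --> \oo] --> (1 : R).
    have w0 : - (n.+1%:R^-1 * `|t|) @[n --> \oo] --> (0 : R).
      rewrite -[X in _ --> X]oppr0 -[X in _ --> - X](mul0r `|t|).
      by apply: cvgN; apply: cvgM; [exact: cvg_harmonic|exact: cvg_cst].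
    have := continuous_cvg _ (@continuous_expR R 0) w0.
    by rewrite expR0; exact.
  rewrite -[H t ^+ 2]mul1r (_ : _ \o _ = fun n => weight n.+1%:R^-1 t * H t ^+ 2).
    by apply: cvgM; [exact: w1|exact: cvg_cst].
  by apply/funext => n; rewrite /= -mulrA -expr2.
have -> : (\int[mu]_t (H t ^+ 2)%:E = \int[mu]_t limn (f ^~ t))%E.
  by apply: eq_integral => t _; rewrite (cvg_lim _ (cf t)).
rewrite (monotone_convergence mu measurableT mf) => [|n t _|t _]; last 2 first.
- exact: f0.
- exact: ndf.
apply: lime_le.
  apply: ereal_nondecreasing_is_cvgn => n m nm; apply: ge0_le_integral => //.
  by move=> t _; exact: ndf.
by apply: nearW => n; exact: integral_weight_sqr_cos_transform_le.
Qed.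

End Plancherel.

(** * Absolutely convergent cosine series *)

Section CosineSeries.
Context {R : realType}.
Notation mu := (@lebesgue_measure R).
Variable b : nat -> R.
Hypothesis sb : cvgn [normed series b].

Definition cosine_sum (w : R) : R :=
  limn (series (fun n => b n * cos (n%:R * w))).
Local Notation S := cosine_sum.
Let Sn n w := series (fun n => b n * cos (n%:R * w)) n.
Let B := limn [normed series b].

Lemma cvg_cosine_sum w : Sn n w @[n --> \oo] --> S w.
Proof.
have : cvgn [normed series (fun n => b n * cos (n%:R * w))].
  apply: series_le_cvg sb => // n; rewrite ?normr_ge0//.
  by rewrite /= normrM ler_piMr// cos_max.
by move=> /normed_cvg.
Qed.

Lemma cosine_sum_partial_dist n w : `|S w - Sn n w| <= B - [normed series b] n.
Proof.
have c1 : `|Sn m w - Sn n w| @[m --> \oo] --> `|S w - Sn n w|.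
  by apply: cvg_norm; apply: cvgB; [exact: cvg_cosine_sum|exact: cvg_cst].
have c2 : [normed series b] m - [normed series b] n @[m --> \oo] -->
    B - [normed series b] n.
  by apply: cvgB; [exact: sb|exact: cvg_cst].
apply: (ler_cvg_to c1 c2); near=> m.
have nm : (n <= m)%N by near: m; exact: nbhs_infty_ge.
rewrite /Sn !sub_series_geq//.
apply: (le_trans (ler_norm_sum _ _ _)); apply: ler_sum => k _.
by rewrite normrM ler_piMr// cos_max.
Unshelve. all: by end_near. Qed.

Lemma cvg_normed_tail : B - [normed series b] n @[n --> \oo] --> (0 : R).
Proof.
by rewrite -(subrr B); apply: cvgB; [exact: cvg_cst|exact: sb].
Qed.

Lemma continuous_cosine_partial n : continuous (Sn n).
Proof.
elim: n => [|n IH] x.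
  have -> : Sn 0 = cst 0.
    by apply/funext => w; rewrite /Sn /series/= big_geq.
  exact: cvg_cst.
have -> : Sn n.+1 = fun w => Sn n w + b n * cos (w * n%:R).
  by apply/funext => w; rewrite /Sn seriesSr (mulrC w).
apply: cvgD; first exact: IH.
by apply: cvgM; [exact: cvg_cst|exact: continuous_cosM].
Qed.

(** The partial sums converge uniformly, by [cosine_sum_partial_dist]. *)
Lemma continuous_cosine_sum : continuous S.
Proof.
move=> x; apply/cvgrPdist_lt => e e0.
have e3 : 0 < e / 3 by rewrite divr_gt0.
have /cvgrPdist_lt/(_ _ e3)[n _ /(_ n (leqnn n))] := cvg_normed_tail.
rewrite /= sub0r normrN => nt.
have t w : `|S w - Sn n w| < e / 3.
  by apply: le_lt_trans nt; apply: le_trans (ler_norm _); exact: cosine_sum_partial_dist.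
have /cvgrPdist_lt/(_ _ e3) := @continuous_cosine_partial n x.
apply: filterS => y /= h.
have -> : S x - S y = (S x - Sn n x) + (Sn n x - Sn n y) - (S y - Sn n y) by ring.
apply: le_lt_trans (ler_normB _ _) _.
have := ler_normD (S x - Sn n x) (Sn n x - Sn n y).
have := t x; have := t y; move: h; lra.
Qed.

(** Uniform convergence of the partial sums against the integrable [u]. *)
Lemma cosine_sum_swap (D : set (measurableTypeR R)) (u : R -> R) :
  measurable D -> mu.-integrable D (EFin \o u) ->
  series (fun n => b n * \int[mu]_(w in D) (u w * cos (n%:R * w))) n
    @[n --> \oo] --> \int[mu]_(w in D) (u w * S w).
Proof.
move=> mD iu.
have mcos k : measurable_fun D (fun w : R => cos (k%:R * w)).
  apply: measurable_funTS; apply: continuous_measurable_fun.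
  by under eq_fun do rewrite mulrC; exact: continuous_cosM.
have icos k : mu.-integrable D (EFin \o (fun w => u w * cos (k%:R * w))).
  by apply: (@integrable_mul_bounded _ _ _ _ 1) => // x _; exact: cos_max.
have iSn n : mu.-integrable D (EFin \o (fun w => u w * Sn n w)).
  apply: (@integrable_mul_bounded _ _ _ _ ([normed series b] n)) => //.
    by apply: measurable_funTS; apply: continuous_measurable_fun; exact: continuous_cosine_partial.
  move=> x _; rewrite /Sn /series /=.
  apply: (le_trans (ler_norm_sum _ _ _)); apply: ler_sum => k _.
  by rewrite normrM ler_piMr// cos_max.
have dS n w : `|S w - Sn n w| <= B - [normed series b] n.
  exact: cosine_sum_partial_dist.
have iS : mu.-integrable D (EFin \o (fun w => u w * S w)).
  apply: (@integrable_mul_bounded _ _ _ _ B) => //.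
    by apply: measurable_funTS; apply: continuous_measurable_fun; exact: continuous_cosine_sum.
  by move=> x _; have := dS 0%N x; rewrite /Sn /series/= !big_geq// subr0 /series/= big_geq// subr0.
have E n : series (fun n => b n * \int[mu]_(w in D) (u w * cos (n%:R * w))) n =
    \int[mu]_(w in D) (u w * Sn n w).
  elim: n => [|n IH].
    rewrite /Sn /series/= big_geq//; under eq_Rintegral do rewrite big_geq// mulr0.
    by rewrite Rintegral_cst// mul0r.
  rewrite seriesSr IH -RintegralZl// -RintegralD//; last first.
    have := integrableZl mD (b n) (icos n).
    by apply: eq_integrable => // w _ /=; rewrite EFinM.
  by apply: eq_Rintegral => w _; rewrite /Sn seriesSr; ring.
under eq_fun do rewrite E.
apply/cvgrPdist_le => e e0.
pose M := \int[mu]_(w in D) `|u w|.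
have M0 : 0 <= M by apply: Rintegral_ge0.
have : (B - [normed series b] n) * M @[n --> \oo] --> 0 * M.
  by apply: cvgM; [exact: cvg_normed_tail|exact: cvg_cst].
rewrite mul0r => /cvgrPdist_le/(_ _ e0); apply: filterS => n /=.
rewrite sub0r normrN => h; apply: le_trans h; apply: le_trans (ler_norm _).
rewrite -RintegralB//.
have iB : mu.-integrable D (EFin \o (fun w => u w * S w - u w * Sn n w)).
  have := integrableB mD iS (iSn n).
  by apply: eq_integrable => // w _ /=; rewrite EFinB.
apply: (le_trans (le_normr_Rintegral _ iB)) => //.
rewrite -RintegralZl//; last exact: integrable_abse iu.
apply: le_Rintegral => //.
- exact: integrable_abse iB.
- have := integrableZl mD (B - [normed series b] n) (integrable_abse iu).
  by apply: eq_integrable => // w _ /=; rewrite EFinM.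
- by move=> w _; rewrite -mulrBr normrM mulrC ler_wpM2r.
Qed.

End CosineSeries.

(** * Uniqueness of cosine coefficients *)

Section CosineUniqueness.
Context {R : realType}.
Notation mu := (@lebesgue_measure R).
Implicit Types (h g : R -> R).
Local Notation I0 := (`[0, pi]%classic : set (measurableTypeR R)).

Lemma continuous_integrable_itv (a b : R) (f : R -> R) : continuous f ->
  mu.-integrable `[a, b] (EFin \o f).
Proof.
move=> cf; apply: continuous_compact_integrable; first exact: segment_compact.
exact: continuous_subspaceT.
Qed.

Lemma continuous_cosMl (c : R) : continuous (fun w : R => cos (c * w)).
Proof. by under eq_fun do rewrite mulrC; exact: continuous_cosM. Qed.

Lemma continuousM_fun (f g : R -> R) : continuous f -> continuous g ->
  continuous (fun w => f w * g w).
Proof. by move=> cf cg w; apply: cvgM; [exact: cf|exact: cg]. Qed.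

Lemma continuousD_fun (f g : R -> R) : continuous f -> continuous g ->
  continuous (fun w => f w + g w).
Proof. by move=> cf cg w; apply: cvgD; [exact: cf|exact: cg]. Qed.

Lemma continuous_cst_fun (c : R) : continuous (fun _ : R => c).
Proof. by move=> w; exact: cvg_cst. Qed.

(** Bundled with continuity because the class of these functions is stable under
    multiplication by trigonometric polynomials, which is how peaked kernels
    are reached. *)
Definition cos_orthogonal h := continuous h /\
  forall k : nat, \int[mu]_(w in `[0, pi]) (h w * cos (k%:R * w)) = 0.

Lemma cos_orthogonal_lin (a b : R) h g : cos_orthogonal h -> cos_orthogonal g ->
  cos_orthogonal (fun w => a * h w + b * g w).
Proof.
move=> [ch oh] [cg og]; split.
  by apply: continuousD_fun; apply: continuousM_fun => //; exact: continuous_cst_fun.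
move=> k.
have ci (f : R -> R) : continuous f ->
    mu.-integrable I0 (EFin \o (fun w => f w * cos (k%:R * w))).
  move=> cf; apply: continuous_integrable_itv; apply: continuousM_fun => //.
  exact: continuous_cosMl.
transitivity (\int[mu]_(w in `[0, pi]) (a * (h w * cos (k%:R * w)) +
                                       b * (g w * cos (k%:R * w)))).
  by apply: eq_Rintegral => w _; ring.
have ciZ c (f : R -> R) : continuous f ->
    mu.-integrable I0 (EFin \o (fun w => c * (f w * cos (k%:R * w)))).
  move=> cf; apply: continuous_integrable_itv; apply: continuousM_fun.
    exact: continuous_cst_fun.
  by apply: continuousM_fun => //; exact: continuous_cosMl.
rewrite RintegralD//; [|exact: ciZ|exact: ciZ].
by rewrite !RintegralZl ?oh ?og ?mulr0 ?addr0//; exact: ci.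
Qed.

(** [2 cos w cos (k w) = cos ((k + 1) w) + cos ((k - 1) w)] shifts the
    coefficients. *)
Lemma cos_orthogonalM h : cos_orthogonal h ->
  cos_orthogonal (fun w => h w * cos w).
Proof.
move=> [ch oh]; split; first exact: continuousM_fun ch (@continuous_cos R).
case=> [|k].
  rewrite -[RHS](oh 1%N); apply: eq_Rintegral => w _.
  by rewrite mul0r cos0 mulr1 mul1r.
have ci j : mu.-integrable I0 (EFin \o (fun w => h w * cos (j%:R * w))).
  apply: continuous_integrable_itv; apply: continuousM_fun => //.
  exact: continuous_cosMl.
transitivity (\int[mu]_(w in `[0, pi])
    (2^-1 * (h w * cos (k.+2%:R * w) + h w * cos (k%:R * w)))).
  apply: eq_Rintegral => w _.
  have -> : k.+2%:R * w = k.+1%:R * w + w by rewrite -!natr1; ring.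
  have -> : k%:R * w = k.+1%:R * w - w by rewrite -!natr1; ring.
  by rewrite cosD cosB; field.
rewrite RintegralZl//; last first.
  apply: continuous_integrable_itv; apply: continuousD_fun;
    by apply: continuousM_fun => //; exact: continuous_cosMl.
by rewrite RintegralD// !oh addr0 mulr0.
Qed.

Lemma cos_orthogonal_quadratic (a b c : R) h : cos_orthogonal h ->
  cos_orthogonal (fun w => h w * (a + b * cos w + c * cos w ^+ 2)).
Proof.
move=> oh; have oh1 := cos_orthogonalM oh; have oh2 := cos_orthogonalM oh1.
have := cos_orthogonal_lin 1 c (cos_orthogonal_lin a b oh oh1) oh2.
by congr cos_orthogonal; apply/funext => w /=; ring.
Qed.

Lemma cos_orthogonal_quadraticX (a b c : R) h n : cos_orthogonal h ->
  cos_orthogonal (fun w => h w * (a + b * cos w + c * cos w ^+ 2) ^+ n).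
Proof.
move=> oh; elim: n => [|n IH].
  by move: oh; congr cos_orthogonal; apply/funext => w; rewrite mulr1.
have := cos_orthogonal_quadratic a b c IH.
by congr cos_orthogonal; apply/funext => w; rewrite (exprSr _ n) mulrA.
Qed.

Lemma ler1n_expr (x : R) n : 0 <= x -> 1 + n%:R * x <= (1 + x) ^+ n.
Proof.
move=> x0; elim: n => [|n IH]; first by rewrite mul0r addr0 expr0.
rewrite exprS; apply: (@le_trans _ _ ((1 + x) * (1 + n%:R * x))).
  rewrite -natr1; have : 0 <= n%:R * x * x by rewrite !mulr_ge0.
  lra.
by rewrite ler_wpM2l// addr_ge0.
Qed.

(** If [h w0 > 0], then [h] is positive near [w0].  The kernel
    [q w = 1 + e - (cos w - cos w0) ^+ 2 / 2] exceeds 1 only near [w0], because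
    [cos] is injective on [[0, pi]], and has absolute value at most 1 elsewhere.
    Hence the integral of [h q ^+ n] grows at least linearly in [n], although it
    vanishes for every [n]. *)
Lemma cos_orthogonal_le0 h : cos_orthogonal h ->
  forall w, 0 < w < pi -> h w <= 0.
Proof.
move=> oh w0 /andP[w00 w0pi]; rewrite leNgt; apply/negP => hw0.
have [ch _] := oh.
set a := h w0 in hw0.
have a2 : 0 < a / 2 by rewrite divr_gt0.
have [d0 /= d0_gt0 hd0] : exists2 d, 0 < d & forall w, `|w - w0| < d -> a / 2 < h w.
  have /cvgrPdist_lt/(_ _ a2) := ch w0.
  move=> /nbhs_ballP[d /= d0 H]; exists d => // w wd.
  have := H w; rewrite /ball/= distrC => /(_ wd).
  by rewrite -/a ltr_norml => /andP[_]; lra.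
(* Within [d1] of [w0] one stays inside the interval and [h > a / 2]. *)
pose d1 := Num.min (d0 / 2) (Num.min (w0 / 2) ((pi - w0) / 2)).
have d1_gt0 : 0 < d1 by rewrite !lt_min !divr_gt0// subr_gt0.
have d1_d0 : d1 < d0.
  by rewrite (@le_lt_trans _ _ (d0 / 2))// ?ge_min ?lexx// ltr_pdivrMr//; lra.
have d1w : d1 <= w0 / 2 by rewrite !ge_min lexx orbT.
have d1p : d1 <= (pi - w0) / 2 by rewrite !ge_min lexx !orbT.
(* Farther than [d1] from [w0], the cosine differs from [cos w0] by at least
   [eta]. *)
pose eta := Num.min (cos (w0 - d1) - cos w0) (cos w0 - cos (w0 + d1)).
have in0 x : 0 <= x -> x <= pi -> x \in `[0, (pi : R)].
  by move=> x0 xp; rewrite in_itv/= x0.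
have eta_gt0 : 0 < eta.
  rewrite lt_min !subr_gt0 !ltr_cos ?in0//; lra.
have far w : 0 <= w -> w <= pi -> d1 < `|w - w0| -> eta <= `|cos w - cos w0|.
  move=> w_0 wp; rewrite ltr_normr => /orP[H|H].
    have : cos w < cos (w0 + d1) by rewrite ltr_cos ?in0//; lra.
    have : eta <= cos w0 - cos (w0 + d1) by rewrite ge_min lexx orbT.
    move=> h1 h2; rewrite distrC; apply: le_trans (ler_norm _); lra.
  have : cos (w0 - d1) < cos w by rewrite ltr_cos ?in0//; lra.
  have : eta <= cos (w0 - d1) - cos w0 by rewrite ge_min lexx.
  move=> h1 h2; apply: le_trans (ler_norm _); lra.
(* With [2 * e <= eta ^+ 2], [q w > 1] forces [w] to be within [d1] of [w0]. *)
pose e := Num.min 1 (eta ^+ 2 / 2).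
have e_gt0 : 0 < e by rewrite lt_min ltr01 divr_gt0// exprn_gt0.
have e1 : e <= 1 by rewrite ge_min lexx.
have e_eta : 2 * e <= eta ^+ 2.
  have : e <= eta ^+ 2 / 2 by rewrite ge_min lexx orbT.
  lra.
have [d2 /= d2_gt0 hd2] : exists2 d, 0 < d &
    forall w, `|w - w0| < d -> (cos w - cos w0) ^+ 2 <= e.
  have /cvgrPdist_lt/(_ _ e_gt0) := @continuous_cos R w0.
  move=> /nbhs_ballP[d /= dpos H]; exists d => // w wd.
  have := H w; rewrite /ball/= distrC => /(_ wd) h1.
  rewrite -sqrrN opprB -real_normK ?num_real// expr2.
  rewrite -[leRHS]mulr1; apply: ler_pM => //; first exact: ltW.
  exact: le_trans (ltW h1) e1.
pose d3 := Num.min d1 (d2 / 2).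
have d3_gt0 : 0 < d3 by rewrite lt_min d1_gt0 divr_gt0.
have d3_d1 : d3 <= d1 by rewrite ge_min lexx.
have d3_d2 : d3 < d2.
  by rewrite (@le_lt_trans _ _ (d2 / 2))// ?ge_min ?lexx ?orbT// ltr_pdivrMr//; lra.
pose q w := 1 + e - (cos w - cos w0) ^+ 2 / 2.
have cnh : {within `[0, (pi : R)], continuous (fun w => `|h w|)}.
  apply: continuous_subspaceT => x; apply: continuous_comp; first exact: ch.
  exact: norm_continuous.
have [c _ hM] := EVT_max (pi_ge0 R) cnh.
pose M := `|h c|.
have lower w n : w \in `[0, (pi : R)] -> - M <= h w * q w ^+ n.
  move=> wI; have := hM w wI; rewrite -/M => hwM.
  have : 0 <= w /\ w <= pi by apply/andP; rewrite in_itv/= in wI.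
  move=> [w_0 wp].
  have M0 : 0 <= M by exact: normr_ge0.
  have [qw1|qw1] := lerP `|q w| 1.
    rewrite lerNl; apply: le_trans (ler_norm _) _; rewrite normrN normrM normrX.
    rewrite -[leRHS]mulr1; apply: ler_pM => //.
    exact: exprn_ile1.
  have csq : (cos w - cos w0) ^+ 2 <= 4.
    have := cos_geN1 w; have := cos_le1 w; have := cos_geN1 w0; have := cos_le1 w0 => *.
    rewrite -real_normK ?num_real// (_ : 4 = 2 ^+ 2); last by ring.
    by rewrite ler_pXn2r ?nnegrE// ler_norml; lra.
  have q1 : 1 < q w.
    move: qw1; rewrite ltr_normr => /orP[//|]; rewrite /q; lra.
  have hpos : 0 < h w.
    apply: lt_trans a2 _; apply: hd0; apply: le_lt_trans d1_d0.
    rewrite leNgt; apply/negP => /(far _ w_0 wp) h1.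
    have : eta ^+ 2 <= (cos w - cos w0) ^+ 2.
      by rewrite -[leRHS]real_normK ?num_real// ler_pXn2r ?nnegrE// ltW.
    move: q1; rewrite /q; lra.
  apply: (@le_trans _ _ 0); first by rewrite oppr_le0.
  by rewrite mulr_ge0 ?exprn_ge0 ?ltW// (lt_trans ltr01).
(* Near [w0] the kernel is at least [1 + e / 2]; Bernoulli's inequality makes
   the growth linear in [n]. *)
have upper w n : `|w - w0| <= d3 -> a / 2 * (1 + n%:R * (e / 2)) <= h w * q w ^+ n.
  move=> wd; have e2 : 0 <= e / 2 by rewrite divr_ge0// ltW.
  have h1 : a / 2 <= h w by apply/ltW/hd0/(le_lt_trans wd)/(le_lt_trans d3_d1).
  have h2 : 1 + e / 2 <= q w.
    by have := hd2 w (le_lt_trans wd d3_d2); rewrite /q; lra.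
  apply: ler_pM => //; first exact: ltW.
    by rewrite addr_ge0// mulr_ge0.
  apply: (le_trans (ler1n_expr n e2)); apply: lerXn2r => //; rewrite nnegrE.
    by rewrite addr_ge0.
  by apply: le_trans h2; rewrite addr_ge0.
have qE w : q w = 1 + e - cos w0 ^+ 2 / 2 + cos w0 * cos w + - 2^-1 * cos w ^+ 2.
  by rewrite /q; field.
have cq : continuous q.
  rewrite (_ : q = fun w => 1 + e - cos w0 ^+ 2 / 2 + cos w0 * cos w + - 2^-1 * (cos w * cos w)).
    do !apply: continuousD_fun => //; try exact: continuous_cst_fun.
      by apply: continuousM_fun; [exact: continuous_cst_fun|exact: continuous_cos].
    apply: continuousM_fun; first exact: continuous_cst_fun.
    by apply: continuousM_fun; exact: continuous_cos.
  by apply/funext => w; rewrite qE expr2.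
have chq n : continuous (fun w => h w * q w ^+ n).
  apply: continuousM_fun => //; elim: n => [|n IH].
    by under eq_fun do rewrite expr0; exact: continuous_cst_fun.
  by under eq_fun do rewrite exprS; exact: continuousM_fun.
(* Adding the constant [M] makes the integrand nonnegative, so that the
   integral can be restricted to the interval of radius [d3]. *)
have key n : a / 2 * (n%:R * (e / 2)) * (2 * d3) <= M * pi.
  have zero : \int[mu]_(w in `[0, pi]) (h w * q w ^+ n) = 0.
    have [_ /(_ 0%N)] := cos_orthogonal_quadraticX (1 + e - cos w0 ^+ 2 / 2)
      (cos w0) (- 2^-1) n oh.
    move=> H; apply: etrans H; apply: eq_Rintegral => w _.
    by rewrite mul0r cos0 mulr1 qE.
  have cF : continuous (fun w => h w * q w ^+ n + M).
    by apply: continuousD_fun => //; exact: continuous_cst_fun.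
  pose I := `[w0 - d3, w0 + d3]%classic : set (measurableTypeR R).
  have wI w : I w -> `|w - w0| <= d3.
    by rewrite /I/= in_itv/= ler_norml => /andP[*]; lra.
  have total : \int[mu]_(w in `[0, pi]) (h w * q w ^+ n + M) = M * pi.
    rewrite RintegralD//.
    - rewrite zero add0r Rintegral_cst//= lebesgue_measure_itv/= lte_fin pi_gt0.
      by rewrite -EFinB subr0.
    - exact: continuous_integrable_itv.
    - by apply: continuous_integrable_itv; exact: continuous_cst_fun.
  rewrite -total -lee_fin -EFin_Rintegral//; last exact: continuous_integrable_itv.
  have mI : measurable I by exact: measurable_itv.
  have mF (D : set (measurableTypeR R)) :
      measurable_fun D (fun w => (h w * q w ^+ n + M)%:E).
    by apply/measurable_EFinP; apply: measurable_funTS; exact: continuous_measurable_fun.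
  apply: (@le_trans _ _ (\int[mu]_(w in I) (h w * q w ^+ n + M)%:E)%E); last first.
    apply: ge0_subset_integral => //.
    - by move=> w wI0; rewrite lee_fin -lerBlDr sub0r lower// inE.
    - move=> w; rewrite /I/= !in_itv/= => /andP[*]; apply/andP; split; lra.
  have -> : (a / 2 * (n%:R * (e / 2)) * (2 * d3))%:E =
      (\int[mu]_(w in I) (cst (a / 2 * (n%:R * (e / 2)))%:E w))%E.
    rewrite integral_cst//= /I lebesgue_measure_itv/= lte_fin ifT; last lra.
    by rewrite -EFinB -EFinM; congr EFin; ring.
  have n0 : 0 <= n%:R * (e / 2) by rewrite mulr_ge0// divr_ge0// ltW.
  apply: ge0_le_integral => //.
  - by move=> w _; rewrite lee_fin mulr_ge0// ltW.
  - move=> w /wI wd; rewrite lee_fin; have := upper w n wd.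
    have : 0 <= M by exact: normr_ge0.
    have : 0 <= a / 2 by exact: ltW.
    rewrite mulrDr; lra.
have : 0 <= M * pi / (a / 2 * (e / 2) * (2 * d3)).
  have M0 : 0 <= M by exact: normr_ge0.
  apply: divr_ge0; first by rewrite mulr_ge0 ?pi_ge0.
  by rewrite !mulr_ge0// ?divr_ge0// ltW.
move=> /archi_boundP; set n := Num.Def.archi_bound _.
rewrite ltr_pdivrMr; last by rewrite !mulr_gt0 ?divr_gt0.
have := key n; lra.
Qed.

Lemma cos_orthogonal_eq0 h : cos_orthogonal h ->
  forall w, 0 <= w <= pi -> h w = 0.
Proof.
move=> oh.
have inner w : 0 < w < pi -> h w = 0.
  move=> wI; apply/eqP; rewrite eq_le cos_orthogonal_le0//=.
  have oh0 := cos_orthogonal_lin (- 1) 0 oh oh.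
  by have := cos_orthogonal_le0 oh0 wI; rewrite mul0r addr0 mulN1r oppr_le0.
have pi0 := pi_gt0 R.
move=> w /andP[w0 wp]; apply/eqP; apply: contraT => hw.
have [ch _] := oh.
have h0 : 0 < `|h w| by rewrite normr_gt0.
have /cvgrPdist_lt/(_ _ h0) := ch w.
move=> /nbhs_ballP[d /= d0 H].
pose t := Num.min (d / 2) (pi / 4).
have t0 : 0 < t by rewrite lt_min !divr_gt0.
have td : t < d by rewrite (@le_lt_trans _ _ (d / 2))// ?ge_min ?lexx// ltr_pdivrMr//; lra.
have tp : t <= pi / 4 by rewrite ge_min lexx orbT.
have [x xI xw] : exists2 x, 0 < x < pi & `|w - x| < d.
  have [wh|wh] := lerP w (pi / 2).
    exists (w + t); first by lra.
    by rewrite opprD addrA subrr sub0r normrN gtr0_norm.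
  exists (w - t); first by lra.
  by rewrite opprB addrCA subrr addr0 gtr0_norm.
by have := H x xw; rewrite (inner x xI) subr0 ltxx.
Qed.

End CosineUniqueness.

(** * Cosine expansion of a smooth function on [0, pi] *)

Section CosineExpansion.
Context {R : realType}.
Notation mu := (@lebesgue_measure R).

(** Comparison with the telescoping series of [1 / (n + 1) - 1 / (n + 2)]. *)
Lemma cvg_normed_series_inv_sqr (b : nat -> R) (C : R) :
  (forall n, `|b n| * n%:R ^+ 2 <= C) -> cvgn [normed series b].
Proof.
move=> bC.
(* [6] is the maximum of [(n + 1) (n + 2) / n ^ 2] over [n >= 1]; the term of
   index 0 is covered by [2 * `|b 0|]. *)
pose K := 6 * C + 2 * `|b 0%N|.
have C0 : 0 <= C by apply: le_trans (bC 0%N); rewrite mulr_ge0// sqr_ge0.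
have K0 : 0 <= K by rewrite addr_ge0// mulr_ge0.
pose v n : R := K * (n.+1%:R^-1 - n.+2%:R^-1).
have vE n : v n = K / (n.+1%:R * n.+2%:R).
  by rewrite /v -!natr1; field; rewrite !natr1 !pnatr_eq0.
have v0 n : 0 <= v n by rewrite vE divr_ge0// mulr_ge0.
have sv n : series v n = K * (1 - n.+1%:R^-1).
  elim: n => [|n IH]; first by rewrite /series/= big_geq// invr1 subrr mulr0.
  by rewrite seriesSr IH /v; ring.
apply: (@series_le_cvg _ _ v) => [n|n|n|]; [exact: normr_ge0|exact: v0| |]; last first.
  apply/cvg_ex; exists (K * (1 - 0)).
  have -> : series v = fun n => K * (1 - n.+1%:R^-1) by apply/funext.
  apply: cvgM; first exact: cvg_cst.
  by apply: cvgB; [exact: cvg_cst|exact: cvg_harmonic].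
rewrite /= vE ler_pdivlMr ?mulr_gt0//.
case: n => [|n].
  rewrite mul1r mulrC.
  have : 0 <= 6 * C by rewrite mulr_ge0.
  rewrite /K; lra.
have := bC n.+1; have := normr_ge0 (b n.+1); move: (`|_|) => x x0 H.
have n1 : (1 : R) <= n.+1%:R by rewrite ler1n.
have h : (n.+2%:R * n.+3%:R : R) <= 6 * n.+1%:R ^+ 2.
  rewrite -[n.+3%:R]natr1 -[n.+2%:R]natr1; nra.
apply: (le_trans (ler_wpM2l x0 h)).
have := normr_ge0 (b 0%N); rewrite /K; lra.
Qed.

Lemma sin_natM_pi k : sin (k%:R * pi) = 0 :> R.
Proof.
elim: k => [|k IH]; first by rewrite mul0r sin0.
by rewrite -natr1 mulrDl mul1r sinDpi IH oppr0.
Qed.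

Lemma Rintegral_cos_nat k :
  \int[mu]_(w in `[0, pi]) cos (k%:R * w) = (k == 0%N)%:R * pi.
Proof.
case: k => [|k].
  under eq_Rintegral do rewrite mul0r cos0.
  by rewrite Rintegral_cst//= lebesgue_measure_itv/= lte_fin pi_gt0 -EFinB subr0.
have dFc (c w : R) : c != 0 -> is_derive w 1 (fun w => sin (c * w) / c) (cos (c * w)).
  by move=> c0; apply: is_derive_eq; rewrite /GRing.scale/=; field.
have dF (w : R) : is_derive w 1 (fun w => sin (k.+1%:R * w) / k.+1%:R) (cos (k.+1%:R * w)).
  by apply: dFc; rewrite pnatr_eq0.
rewrite (Rintegral_FTC (pi_ge0 R) _ dF); last exact: continuous_cosMl.
by rewrite sin_natM_pi mulr0 sin0 !mul0r subrr.
Qed.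

(** The inverse of the squared norm of [cos (n w)] in L2 of [[0, pi]]. *)
Definition cosine_weight (n : nat) : R := (if n == 0%N then 1 else 2) / pi.

Lemma cosine_weight_gt0 n : 0 < cosine_weight n.
Proof. by rewrite divr_gt0 ?pi_gt0//; case: ifP. Qed.

Lemma cosine_orthogonality n k :
  \int[mu]_(w in `[0, pi]) (cos (k%:R * w) * cos (n%:R * w)) =
  (n == k)%:R / cosine_weight n.
Proof.
wlog kn : n k / (k <= n)%N => [H|].
  have [/H//|/ltnW/H] := leqP k n.
  rewrite eq_sym; under eq_Rintegral do rewrite mulrC.
  by move=> ->; have [->|] := eqVneq n k; rewrite ?mul0r.
have i j : mu.-integrable `[0, (pi : R)] (EFin \o (fun w => cos (j%:R * w))).
  by apply: continuous_integrable_itv; exact: continuous_cosMl.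
transitivity (\int[mu]_(w in `[0, pi])
   (2^-1 * (cos ((n + k)%:R * w) + cos ((n - k)%:R * w)))).
  apply: eq_Rintegral => w _.
  by rewrite natrD natrB// mulrDl mulrBl cosD cosB; field.
rewrite RintegralZl//; last first.
  by apply: continuous_integrable_itv; apply: continuousD_fun; exact: continuous_cosMl.
rewrite RintegralD// !Rintegral_cos_nat addn_eq0 subn_eq0 /cosine_weight.
have pi0 : (pi : R) != 0 by rewrite gt_eqF ?pi_gt0.
have [->|nk] := eqVneq n k.
  by rewrite leqnn andbb; case: (k == 0%N) => /=; move: pi pi0 => p p0; field.
have -> : (n <= k)%N = false.
  by apply/negbTE; rewrite -ltnNge ltn_neqAle [k == n]eq_sym nk kn.
case: n kn nk => [|n]; first by rewrite leqn0 eq_sym => ->.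
by rewrite !mul0r addr0 mulr0.
Qed.

(** Two integrations by parts at once: [D1 w * cos (k w) + k * D w * sin (k w)] is
    an antiderivative of [D2 w * cos (k w) + k ^+ 2 * (D w * cos (k w))], and the
    sine vanishes at both ends. *)
Lemma cosine_coef_decay (D D1 D2 : R -> R) :
  (forall w : R, is_derive w 1 D (D1 w)) -> (forall w : R, is_derive w 1 D1 (D2 w)) ->
  continuous D2 ->
  exists C, forall k : nat,
    `|\int[mu]_(w in `[0, pi]) (D w * cos (k%:R * w))| * k%:R ^+ 2 <= C.
Proof.
move=> dD dD1 cD2.
have cD := derivable_continuous_all dD.
have cD1 := derivable_continuous_all dD1.
exists (`|D1 pi| + `|D1 0| + \int[mu]_(w in `[0, pi]) `|D2 w|) => k.
have dF (w : R) : is_derive w 1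
    (fun w => D1 w * cos (k%:R * w) + k%:R * D w * sin (k%:R * w))
    (D2 w * cos (k%:R * w) + k%:R ^+ 2 * (D w * cos (k%:R * w))).
  have h1 := dD w; have h2 := dD1 w.
  by apply: is_derive_eq; rewrite /GRing.scale/=; ring.
have cDc (f : R -> R) : continuous f -> continuous (fun w => f w * cos (k%:R * w)).
  by move=> cf; apply: continuousM_fun => //; exact: continuous_cosMl.
have cDk : continuous (fun w => k%:R ^+ 2 * (D w * cos (k%:R * w))).
  by apply: continuousM_fun; [exact: continuous_cst_fun|exact: cDc].
have := Rintegral_FTC (pi_ge0 R) (continuousD_fun (cDc _ cD2) cDk) dF.
rewrite RintegralD//; [|exact/continuous_integrable_itv/cDc|exact: continuous_integrable_itv].
rewrite RintegralZl//; last exact/continuous_integrable_itv/cDc.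
rewrite sin_natM_pi mulr0 addr0 mulr0 sin0 cos0 mulr0 addr0 mulr1.
set J := \int[mu]_(w in _) (D w * _); set J2 := \int[mu]_(w in _) (D2 w * _) => E.
have -> : `|J| * k%:R ^+ 2 = `|D1 pi * cos (k%:R * pi) - D1 0 - J2|.
  by rewrite -E addrAC subrr add0r normrM mulrC [X in _ = X * _]ger0_norm ?sqr_ge0.
apply: (le_trans (ler_normB _ _)); apply: lerD.
  apply: (le_trans (ler_normB _ _)); rewrite lerD2r normrM ler_piMr// cos_max//.
have i2 := continuous_integrable_itv 0 pi (cDc _ cD2).
apply: (le_trans (le_normr_Rintegral _ i2)) => //.
apply: le_Rintegral => //.
- exact: integrable_abse i2.
- exact: (integrable_abse (continuous_integrable_itv 0 pi cD2)).
- by move=> w _; rewrite normrM ler_piMr// cos_max.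
Qed.

Definition cosine_coef (D : R -> R) (n : nat) : R :=
  cosine_weight n * \int[mu]_(w in `[0, pi]) (D w * cos (n%:R * w)).

Lemma cosine_coef_summable (D D1 D2 : R -> R) :
  (forall w : R, is_derive w 1 D (D1 w)) -> (forall w : R, is_derive w 1 D1 (D2 w)) ->
  continuous D2 ->
  exists C, forall n, `|cosine_coef D n| * n%:R ^+ 2 <= C.
Proof.
move=> dD dD1 cD2; have [C HC] := cosine_coef_decay dD dD1 cD2.
exists (2 / pi * C) => n; rewrite normrM -[leLHS]mulrA; apply: ler_pM => //.
rewrite (gtr0_norm (cosine_weight_gt0 n)) /cosine_weight ler_pM2r ?invr_gt0 ?pi_gt0//.
by case: ifP => //; rewrite ler1n.
Qed.

(** The sum of the series and [D] have the same cosine coefficients, by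
    orthogonality. *)
Lemma cosine_expansion (D : R -> R) :
  continuous D -> cvgn [normed series (cosine_coef D)] ->
  forall w, 0 <= w <= pi -> cosine_sum (cosine_coef D) w = D w.
Proof.
move=> cD sb; set b := cosine_coef D.
have cS := continuous_cosine_sum sb.
have oh : cos_orthogonal (fun w => 1 * cosine_sum b w + - 1 * D w).
  split; first by apply: continuousD_fun; apply: continuousM_fun => //; exact: continuous_cst_fun.
  move=> k.
  have ick (f : R -> R) : continuous f ->
      mu.-integrable `[0, (pi : R)] (EFin \o (fun w => f w * cos (k%:R * w))).
    move=> cf; apply: continuous_integrable_itv; apply: continuousM_fun => //.
    exact: continuous_cosMl.
  transitivity (\int[mu]_(w in `[0, pi]) (cosine_sum b w * cos (k%:R * w) - D w * cos (k%:R * w))).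
    by apply: eq_Rintegral => w _; ring.
  rewrite RintegralB//; [|exact: ick|exact: ick].
  have ic : mu.-integrable `[0, (pi : R)] (EFin \o (fun w => cos (k%:R * w))).
    by apply: continuous_integrable_itv; exact: continuous_cosMl.
  have := cosine_sum_swap sb (measurable_itv `[0, pi]) ic.
  set s := series _ => sE.
  suff : s n @[n --> \oo] --> \int[mu]_(w in `[0, pi]) (D w * cos (k%:R * w)).
    move=> /(cvg_lim (@Rhausdorff R)) sD.
    move/(cvg_lim (@Rhausdorff R)): sE; rewrite sD => ->.
    by apply/eqP; rewrite subr_eq0; apply/eqP/eq_Rintegral => w _; rewrite mulrC.
  (* By orthogonality only the term of index [k] survives. *)
  apply: cvg_near_cst; exists k.+1 => // n /= kn.
  rewrite /s /series/= (bigD1_seq k) ?mem_index_iota ?iota_uniq//=.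
  rewrite cosine_orthogonality eqxx big1 => [|j jk]; last first.
    by rewrite cosine_orthogonality (negbTE jk) mul0r mulr0.
  rewrite addr0 /b /cosine_coef mulrAC mul1r mulfV ?mul1r//.
  by rewrite gt_eqF// cosine_weight_gt0.
move=> w wI; have := cos_orthogonal_eq0 oh wI.
by rewrite mul1r mulN1r => /eqP; rewrite subr_eq0 => /eqP.
Qed.

End CosineExpansion.

(** * The inverse of the symbol *)

Section Symbol.
Context {R : realType}.
Variable s : R.
Hypothesis s0 : 0 < s.

(** Up to a constant, the symbol of the integer samples of [lorentz s] on
    [[0, 2 pi]]; the argument [s (pi - w)] makes it symmetric about [pi]. *)
Definition twice_cosh (w : R) := expR (s * (pi - w)) + expR (- (s * (pi - w))).
Definition twice_sinh (w : R) := expR (s * (pi - w)) - expR (- (s * (pi - w))).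
(** The inverse of the symbol
    [pi * s * cosh (s (pi - w)) / sinh (pi * s)], valid on [[0, 2 pi]] only. *)
Definition inv_symbol (w : R) := twice_sinh 0 / (pi * s) / twice_cosh w.

Lemma twice_cosh_gt0 w : 0 < twice_cosh w.
Proof. by rewrite addr_gt0 ?expR_gt0. Qed.

Lemma twice_sinh0_gt0 : 0 < twice_sinh 0.
Proof.
by rewrite subr_gt0 ltr_expR subr0 gtrN// mulr_gt0 ?pi_gt0.
Qed.

Lemma twice_cosh_ge2 w : 2 <= twice_cosh w.
Proof.
rewrite /twice_cosh expRN; set x := expR _; have x0 : 0 < x by exact: expR_gt0.
rewrite -subr_ge0 (_ : _ - _ = (x - 1) ^+ 2 / x); last by field; rewrite gt_eqF.
by rewrite divr_ge0 ?sqr_ge0// ltW.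
Qed.

Lemma is_derive_twice_cosh (w : R) : is_derive w 1 twice_cosh (- s * twice_sinh w).
Proof. by rewrite /twice_cosh /twice_sinh; apply: is_derive_eq; rewrite /GRing.scale/=; ring. Qed.

Lemma is_derive_twice_sinh (w : R) : is_derive w 1 twice_sinh (- s * twice_cosh w).
Proof. by rewrite /twice_cosh /twice_sinh; apply: is_derive_eq; rewrite /GRing.scale/=; ring. Qed.

Lemma continuous_twice_cosh : continuous twice_cosh.
Proof. exact: derivable_continuous_all is_derive_twice_cosh. Qed.

Lemma continuous_twice_sinh : continuous twice_sinh.
Proof. exact: derivable_continuous_all is_derive_twice_sinh. Qed.

Lemma is_derive_twice_coshV (w : R) : is_derive w 1 (fun w => (twice_cosh w)^-1) (s * twice_sinh w / twice_cosh w ^+ 2).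
Proof.
have h := is_derive_twice_cosh w; have c0 : twice_cosh w != 0 by rewrite gt_eqF ?twice_cosh_gt0.
apply: is_derive_eq; rewrite /GRing.scale/=; field.
by rewrite c0.
Qed.

Lemma continuous_twice_coshV : continuous (fun w => (twice_cosh w)^-1).
Proof. exact: derivable_continuous_all is_derive_twice_coshV. Qed.

Lemma inv_symbol_coef_summable :
  exists C, forall n, `|cosine_coef inv_symbol n| * n%:R ^+ 2 <= C.
Proof.
pose N := twice_sinh 0 / (pi * s).
have dD (w : R) : is_derive w 1 inv_symbol (N * (s * twice_sinh w * (twice_cosh w)^-1 ^+ 2)).
  have h := is_derive_twice_coshV w; rewrite /inv_symbol -/N.
  by apply: is_derive_eq; rewrite /GRing.scale/= exprVn; ring.
have dD1 (w : R) : is_derive w 1 (fun w => N * (s * twice_sinh w * (twice_cosh w)^-1 ^+ 2))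
    (N * (s * (- s * twice_cosh w * (twice_cosh w)^-1 ^+ 2 +
       twice_sinh w * (2 * (twice_cosh w)^-1 * (s * twice_sinh w * (twice_cosh w)^-1 ^+ 2))))).
  have h1 := is_derive_twice_coshV w; have h2 := is_derive_twice_sinh w.
  by apply: is_derive_eq; rewrite /GRing.scale/= -!exprVn; ring.
apply: (cosine_coef_summable dD dD1).
have cV2 : continuous (fun w : R => (twice_cosh w)^-1 ^+ 2).
  by under eq_fun do rewrite expr2; apply: continuousM_fun; exact: continuous_twice_coshV.
have cc := continuous_cst_fun; have csh := continuous_twice_sinh; have cch := continuous_twice_cosh.
have cV := continuous_twice_coshV.
apply: continuousM_fun; first exact: cc.
apply: continuousM_fun; first exact: cc.
apply: continuousD_fun.
  by apply: continuousM_fun => //; apply: continuousM_fun.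
apply: continuousM_fun => //; apply: continuousM_fun; apply: continuousM_fun => //.
exact: continuousM_fun.
Qed.

(** Coefficients of the one-sided expansion of [inv_symbol] in cosines; they are
    twice the [d_k] for [k > 0]. *)
Definition nod_weight := cosine_coef inv_symbol.

Lemma nod_weight_summable : cvgn [normed series nod_weight].
Proof. by have [C /cvg_normed_series_inv_sqr] := inv_symbol_coef_summable. Qed.

(** The even [2 pi]-periodic extension of the restriction of [inv_symbol] to
    [[0, pi]]. *)
Definition inv_symbol_per := cosine_sum nod_weight.
Local Notation S := inv_symbol_per.

Lemma inv_symbol_perE w : 0 <= w <= pi -> S w = inv_symbol w.
Proof.
apply: cosine_expansion; last exact: nod_weight_summable.
by apply: continuousM_fun; [exact: continuous_cst_fun|exact: continuous_twice_coshV].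
Qed.

Lemma continuous_inv_symbol_per : continuous S.
Proof. exact: continuous_cosine_sum nod_weight_summable. Qed.

Lemma inv_symbol_per_even w : S (- w) = S w.
Proof.
rewrite /S /cosine_sum; congr (limn (series _)).
by apply/funext => n; rewrite mulrN cosN.
Qed.

Lemma inv_symbol_per_periodic w (k : nat) : S (w + pi *+ 2 *+ k) = S w.
Proof.
rewrite /S /cosine_sum; congr (limn (series _)).
apply/funext => n; rewrite mulrDr [n%:R * (_ *+ _)]mulr_natl -(mulrnA (pi *+ 2)).
by rewrite (periodicn (@cosD2pi R)).
Qed.

Lemma inv_symbol_per_reduce w : exists2 v, 0 <= v <= pi & S w = S v.
Proof.
have [v v0 ->] : exists2 v, 0 <= v & S w = S v.
  have [w0|w0] := leP 0 w; first by exists w.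
  by exists (- w); rewrite ?inv_symbol_per_even// oppr_ge0 ltW.
have p2 : 0 < pi *+ 2 :> R by rewrite mulrn_wgt0 ?pi_gt0.
pose k := Num.truncn (v / (pi *+ 2)).
have /andP[k1 k2] : k%:R <= v / (pi *+ 2) < k.+1%:R.
  by apply: truncn_itv; rewrite divr_ge0// ltW.
pose x := v - pi *+ 2 *+ k.
have -> : S v = S x by rewrite -(inv_symbol_per_periodic x k) subrK.
have x0 : 0 <= x by rewrite subr_ge0 -mulr_natl -ler_pdivlMr.
have x2 : x < pi *+ 2.
  by rewrite ltrBlDr -mulrS -[X in _ < X]mulr_natl -ltr_pdivrMr.
have [xp|px] := leP x pi; first by exists x; rewrite ?x0.
exists (pi *+ 2 - x).
  by rewrite subr_ge0 ltW//= lerBlDr mulr2n lerD2l ltW.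
by rewrite -inv_symbol_per_even -(inv_symbol_per_periodic (- x) 1) mulr1n addrC.
Qed.

(** [2 <= twice_cosh], and every point is carried into [[0, pi]] by periodicity
    and evenness. *)
Lemma inv_symbol_per_bound w : 0 <= S w <= twice_sinh 0 / (2 * pi * s).
Proof.
have [v vI ->] := inv_symbol_per_reduce w; rewrite inv_symbol_perE// /inv_symbol.
have N0 := twice_sinh0_gt0; have c0 := twice_cosh_gt0 v; have c2 := twice_cosh_ge2 v.
have ps : 0 < pi * s by rewrite mulr_gt0 ?pi_gt0.
apply/andP; split; first by rewrite !divr_ge0 ?ltW.
rewrite (_ : 2 * pi * s = 2 * (pi * s)); last by rewrite mulrA.
rewrite -mulrA ler_pM2l// -invfM lef_pV2 ?posrE ?mulr_gt0 ?pi_gt0//.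
by rewrite mulrC ler_pM2l.
Qed.

End Symbol.

(** * The nod function as a Fourier integral *)

Section NodFunction.
Context {R : realType}.
Notation mu := (@lebesgue_measure R).
Variable s : R.
Hypothesis s0 : 0 < s.
Local Notation b := (nod_weight s).
Local Notation S := (inv_symbol_per s).
Local Notation phi := (lorentz s).

Lemma lorentz_even t : phi (- t) = phi t.
Proof. by rewrite /lorentz sqrrN. Qed.

Lemma lorentz_den_gt0 t : 0 < s ^+ 2 + t ^+ 2.
Proof. by rewrite ltr_wpDr ?sqr_ge0 ?exprn_gt0. Qed.

Lemma lorentz_ge0 t : 0 <= phi t.
Proof. by rewrite divr_ge0 ?sqr_ge0 ?ltW ?lorentz_den_gt0. Qed.

Lemma lorentz_le1 t : phi t <= 1.
Proof. by rewrite /lorentz ler_pdivrMr ?lorentz_den_gt0// mul1r lerDl sqr_ge0. Qed.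

Lemma sin_intM_pi (k : int) : sin (k%:~R * pi) = 0 :> R.
Proof.
case: k => k; first exact: sin_natM_pi.
by rewrite NegzE mulrNz mulNr sinN sin_natM_pi oppr0.
Qed.

Lemma cos_intM (m : int) w : cos (m%:~R * w) = cos (`|m|%N%:R * w) :> R.
Proof. by case: m => k; rewrite ?NegzE ?mulrNz ?mulNr ?cosN// abszN. Qed.

(** The [k]-th cosine coefficient of [twice_cosh] is proportional to
    [lorentz s k]; the sine terms of the antiderivative vanish at both ends
    because [k] is an integer. *)
Lemma lorentz_int (k : int) : phi k%:~R =
  s / twice_sinh s 0 * \int[mu]_(w in `[0, pi]) (twice_cosh s w * cos (k%:~R * w)).
Proof.
set c : R := k%:~R.
have dF (w : R) : is_derive w 1
    (fun w => (s ^+ 2 + c ^+ 2)^-1 * (- s * twice_sinh s w * cos (c * w) + c * twice_cosh s w * sin (c * w)))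
    (twice_cosh s w * cos (c * w)).
  have h1 := is_derive_twice_cosh s w; have h2 := is_derive_twice_sinh s w.
  apply: is_derive_eq; rewrite /GRing.scale/=; field.
  by rewrite gt_eqF ?lorentz_den_gt0.
rewrite (Rintegral_FTC (pi_ge0 R) _ dF); last first.
  by apply: continuousM_fun; [exact: continuous_twice_cosh|exact: continuous_cosMl].
rewrite sin_intM_pi (mulr0 c) sin0 cos0 /lorentz -/c.
have -> : twice_sinh s pi = 0 by rewrite /twice_sinh subrr mulr0 oppr0 subrr.
have := twice_sinh0_gt0 s0; have := lorentz_den_gt0 c; set x := twice_sinh s 0 => h1 h2.
by field; rewrite !gt_eqF.
Qed.

(** Since the [d_k] are even in [k], only the mean of two opposite shifts
    matters; [shift_pair 0] is [phi]. *)
Definition shift_pair (n : nat) (t : R) := (phi (t - n%:R) + phi (t + n%:R)) / 2.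

(** The variable [t] enters through a cosine only, and by [shift_pairE] the index
    [n] of a pair of shifts does too: the series over [n] can be summed under
    the integral. *)
Definition nod_density (t w : R) := s / 2 * (expR (- (s * `|w|)) * cos (w * t)).

Lemma integrable_nod_density t : mu.-integrable setT (EFin \o nod_density t).
Proof.
have mc : measurable_fun [set: measurableTypeR R] (fun w : R => cos (w * t)).
  by apply: continuous_measurable_fun; exact: continuous_cosM.
have i1 : mu.-integrable setT (EFin \o (fun w => expR (- (s * `|w|)) * cos (w * t))).
  apply: (@integrable_mul_bounded _ _ _ _ 1) => //; first exact: integrable_expRN_norm.
  by move=> x _; exact: cos_max.
have := integrableZl measurableT (s / 2) i1.
by apply: eq_integrable => // w _ /=; rewrite -EFinM.
Qed.

Lemma shift_pairE n t :
  shift_pair n t = \int[mu]_w (nod_density t w * cos (n%:R * w)).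
Proof.
have mc u : measurable_fun [set: measurableTypeR R] (fun w : R => cos (w * u)).
  by apply: continuous_measurable_fun; exact: continuous_cosM.
have i1 u : mu.-integrable setT (EFin \o (fun w => expR (- (s * `|w|)) * cos (w * u))).
  apply: (@integrable_mul_bounded _ _ _ _ 1) => //; first exact: integrable_expRN_norm.
  by move=> x _; exact: cos_max.
transitivity (\int[mu]_w (s / 4 * (expR (- (s * `|w|)) * cos (w * (t - n%:R)) +
    expR (- (s * `|w|)) * cos (w * (t + n%:R))))); last first.
  apply: eq_Rintegral => w _; rewrite /nod_density.
  rewrite (mulrBr w) (mulrDr w) cosB cosD (mulrC n%:R w).
  by field.
rewrite RintegralZl//; last exact: (integrableD _ (i1 (t - n%:R)) (i1 (t + n%:R))).
rewrite RintegralD// !Rintegral_expR_cos// /shift_pair /lorentz.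
by field; rewrite !gt_eqF// lorentz_den_gt0.
Qed.

(** The integral form is the definition, so that the comparison with the sinc
    function is direct; [nod_fun_series] recovers the series of shifts. *)
Definition nod_fun t := \int[mu]_w (nod_density t w * S w).

Lemma nod_fun_series t :
  series (fun n => b n * shift_pair n t) n @[n --> \oo] --> nod_fun t.
Proof.
rewrite (_ : (fun n => b n * shift_pair n t) = (fun n => b n *
    \int[mu]_w (nod_density t w * cos (n%:R * w)))); last first.
  by apply/funext => n; rewrite shift_pairE.
exact: (cosine_sum_swap (@nod_weight_summable R s) measurableT (integrable_nod_density t)).
Qed.

Lemma shift_pair_int n (m : int) : shift_pair n m%:~R =
  \int[mu]_(w in `[0, pi]) ((s / twice_sinh s 0 * twice_cosh s w * cos (m%:~R * w)) * cos (n%:R * w)).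
Proof.
have ic u : mu.-integrable `[0, (pi : R)] (EFin \o (fun w => twice_cosh s w * cos (u * w))).
  apply: continuous_integrable_itv; apply: continuousM_fun;
    [exact: continuous_twice_cosh|exact: continuous_cosMl].
transitivity (\int[mu]_(w in `[0, pi]) (s / twice_sinh s 0 / 2 *
   (twice_cosh s w * cos ((m - Posz n)%:~R * w) + twice_cosh s w * cos ((m + Posz n)%:~R * w)))).
  rewrite RintegralZl//; last exact: (integrableD _ (ic _) (ic _)).
  rewrite RintegralD// /shift_pair.
  have -> : m%:~R - n%:R = (m - Posz n)%:~R :> R by rewrite rmorphB.
  have -> : m%:~R + n%:R = (m + Posz n)%:~R :> R by rewrite rmorphD.
  by rewrite !lorentz_int; field; rewrite gt_eqF ?twice_sinh0_gt0.
apply: eq_Rintegral => w _.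
have -> : (m - Posz n)%:~R * w = m%:~R * w - n%:R * w by rewrite rmorphB mulrBl.
have -> : (m + Posz n)%:~R * w = m%:~R * w + n%:R * w by rewrite rmorphD mulrDl.
by rewrite cosB cosD; field; rewrite gt_eqF ?twice_sinh0_gt0.
Qed.

(** At integers, [lorentz_int] replaces the integral over the line by one over
    [[0, pi]], in which the symbol cancels its inverse. *)
Lemma nod_fun_int (m : int) : nod_fun m%:~R = (m == 0)%:R.
Proof.
have iu : mu.-integrable `[0, (pi : R)]
    (EFin \o (fun w => s / twice_sinh s 0 * twice_cosh s w * cos (m%:~R * w))).
  apply: continuous_integrable_itv; apply: continuousM_fun; last exact: continuous_cosMl.
  by apply: continuousM_fun; [exact: continuous_cst_fun|exact: continuous_twice_cosh].
have := cosine_sum_swap (@nod_weight_summable R s) (measurable_itv `[0, pi]) iu.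
rewrite (_ : (fun n => b n * _) = (fun n => b n * shift_pair n m%:~R)); last first.
  by apply/funext => n; rewrite shift_pair_int.
have /(cvg_lim (@Rhausdorff R)) h1 := @nod_fun_series m%:~R.
move=> /(cvg_lim (@Rhausdorff R)); rewrite h1 => ->.
have N0 := twice_sinh0_gt0 s0; have p0 := pi_gt0 R.
transitivity (\int[mu]_(w in `[0, pi]) (pi^-1 * cos (`|m|%N%:R * w))).
  apply: eq_Rintegral => w; rewrite inE/= in_itv/= => wI.
  rewrite -/(S w) inv_symbol_perE// /inv_symbol.
  rewrite cos_intM.
  have := twice_cosh_gt0 s w => c0; move: pi p0 => p p0.
  by field; rewrite !gt_eqF.
rewrite RintegralZl//; last by apply: continuous_integrable_itv; exact: continuous_cosMl.
rewrite Rintegral_cos_nat absz_eq0 mulrCA mulVf ?mulr1//.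
by rewrite gt_eqF.
Qed.

End NodFunction.

(** * Existence of the nod function *)

Section Existence.
Context {R : realType}.

Lemma esum_nat_lty (u : nat -> R) : (forall n, 0 <= u n) -> cvgn (series u) ->
  (\esum_(n in [set: nat]) (u n)%:E < +oo)%E.
Proof.
move=> u0 cu; rewrite -nneseries_esumT//.
have -> : (\sum_(n <oo) (u n)%:E = (limn (series u))%:E)%E.
  apply/cvg_lim => //; apply: cvg_EFin; first by apply: nearW => n; rewrite sumEFin.
  rewrite (_ : _ \o _ = series u)//.
  by apply/funext => n; rewrite /= sumEFin.
by rewrite ltry.
Qed.

Lemma summable_int (a : int -> R) :
  cvgn [normed series (fun n => a (Posz n))] ->
  cvgn [normed series (fun n => a (Negz n))] ->
  summable [set: int] (EFin \o a).
Proof.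
move=> cp cn; rewrite /summable (esumID (range Posz))//.
rewrite !setTI.
have -> : ~` range Posz = range Negz.
  apply/seteqP; split => [[n|n] /=|_ [n _ <-]]; last by case.
  - by case; exists n.
  - by move=> _; exists n.
have iP : set_inj [set: nat] Posz by move=> m n _ _ [].
have iN : set_inj [set: nat] Negz by move=> m n _ _ [].
rewrite !esum_image//; apply: lte_add_pinfty.
- exact: (esum_nat_lty (fun n => normr_ge0 _) cp).
- exact: (esum_nat_lty (fun n => normr_ge0 _) cn).
Qed.

Variable s : R.
Hypothesis s0 : 0 < s.
Local Notation b := (nod_weight s).
Local Notation phi := (lorentz s).

Definition nod_coef (k : int) : R := if k == 0 then b 0%N else b `|k|%N / 2.

Lemma nod_coef_decay : exists C, forall k : int,
  `|nod_coef k| * (1 + k%:~R ^+ 2) <= C.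
Proof.
have [C HC] := inv_symbol_coef_summable s.
exists (`|b 0%N| + C) => k; rewrite /nod_coef.
have C0 : 0 <= C by apply: le_trans (HC 0%N); rewrite mulr_ge0// sqr_ge0.
case: eqP => [->|/eqP k0]; first by rewrite expr0n/= addr0 mulr1 lerDl.
have -> : (k%:~R : R) ^+ 2 = `|k|%N%:R ^+ 2.
  by rewrite -[LHS]real_normK ?num_real// -intr_norm -abszE.
have := HC `|k|%N; rewrite -/b.
have n1 : (1 : R) <= `|k|%N%:R by rewrite ler1n absz_gt0.
move: (`|k|%N%:R) n1 => x x1.
rewrite (normrM (b `|k|%N) 2^-1); have := normr_ge0 (b `|k|%N); move: (`|b `|k|%N|) => y y0 H.
have -> : `|2^-1| = 2^-1 :> R by rewrite ger0_norm.
have := normr_ge0 (b 0%N).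
have : y * (1 + x ^+ 2) <= y * (2 * x ^+ 2) by rewrite ler_wpM2l//; nra.
lra.
Qed.

Lemma nod_coef_bound : exists C, forall k : int, `|nod_coef k| <= C.
Proof.
have [C HC] := nod_coef_decay; exists C => k; apply: le_trans (HC k).
by rewrite ler_peMr// lerDl sqr_ge0.
Qed.

(** The two halves of a bilateral series are treated at once: [h] is [Posz] or
    [Negz]. *)
Lemma cvg_half_series (h : nat -> int) (v : int -> R) (M : R) :
  (forall n, (n%:R : R) ^+ 2 <= (h n)%:~R ^+ 2) ->
  (forall k, `|v k| <= M) ->
  cvgn [normed series (fun n => nod_coef (h n) * v (h n))].
Proof.
move=> hh vM; have [C HC] := nod_coef_decay.
apply: (@cvg_normed_series_inv_sqr _ _ (C * M)) => n.
rewrite normrM mulrAC; apply: ler_pM => //.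
apply: le_trans (HC (h n)); rewrite ler_wpM2l//.
by apply: le_trans (hh n) _; rewrite lerDr.
Qed.

Lemma sqr_Posz n : (n%:R : R) ^+ 2 <= (Posz n)%:~R ^+ 2.
Proof. by []. Qed.

Lemma sqr_Negz n : (n%:R : R) ^+ 2 <= (Negz n)%:~R ^+ 2.
Proof.
by rewrite NegzE mulrNz sqrrN ler_pXn2r ?nnegrE// ler_nat.
Qed.

Lemma ell2_nod_coef : ell2 nod_coef.
Proof.
have [C HC] := nod_coef_bound; rewrite /ell2.
have := @summable_int (fun k => nod_coef k * nod_coef k).
by apply; [apply: (cvg_half_series sqr_Posz HC)|apply: (cvg_half_series sqr_Negz HC)].
Qed.

Lemma bilateral_nod_fun t :
  bilateral_sum (fun k => nod_coef k * phi (t - k%:~R)) (nod_fun s t).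
Proof.
have phi1 (k : int) : `|phi (t - k%:~R)| <= 1.
  by rewrite ger0_norm ?lorentz_le1// lorentz_ge0.
have cp := normed_cvg (cvg_half_series sqr_Posz phi1).
have cn := normed_cvg (cvg_half_series sqr_Negz phi1).
exists (limn (series (fun n => nod_coef (Posz n) * phi (t - (Posz n)%:~R)))).
exists (limn (series (fun n => nod_coef (Negz n) * phi (t - (Negz n)%:~R)))).
split; [exact: cp|exact: cn|].
set u := series _ in cp *; set v := series _ in cn *.
(* The index 0 belongs to the nonnegative half only, so this half is taken one
   term further. *)
have E n : u n.+1 + v n = series (fun n => b n * shift_pair s n t) n.+1.
  elim: n => [|n IH].
    rewrite /u /v /series/= !big_nat1 big_geq// addr0 /nod_coef/= /shift_pair.
    by rewrite subr0 addr0; field.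
  rewrite seriesSr -IH /u /v !seriesSr /nod_coef /shift_pair/=.
  by rewrite NegzE mulrNz opprK; field.
have c1 : (u n.+1 + v n) @[n --> \oo] --> limn u + limn v.
  by apply: cvgD; [rewrite (cvg_shiftS u)|].
have c2 : series (fun n => b n * shift_pair s n t) n.+1 @[n --> \oo] --> nod_fun s t.
  by rewrite (cvg_shiftS (series (fun n => b n * shift_pair s n t))); exact: nod_fun_series.
rewrite (_ : (fun n => u n.+1 + v n) = fun n =>
  series (fun n => b n * shift_pair s n t) n.+1) in c1; last exact/funext.
by move/(cvg_lim (@Rhausdorff R)): c1 => <-; move/(cvg_lim (@Rhausdorff R)): c2.
Qed.

Lemma basic_nod_function_nod_fun : basic_nod_function phi (nod_fun s).
Proof.
split; last exact: nod_fun_int.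
by exists nod_coef; [exact: ell2_nod_coef|exact: bilateral_nod_fun].
Qed.

End Existence.

(** * Injectivity of the convolution with the Lorentz samples *)

Section Uniqueness.
Context {R : realType}.
Implicit Types a g : int -> R.

(** A single index set for the partial sums of both halves of a bilateral series,
    so that two truncated series are exchanged as finite sums. *)
Definition int_window N : seq int :=
  [seq Posz n | n <- index_iota 0 N] ++ [seq Negz n | n <- index_iota 0 N].

Definition window_sum N a := \sum_(k <- int_window N) a k.

Lemma window_sumE N a : window_sum N a =
  series (fun n => a (Posz n)) N + series (fun n => a (Negz n)) N.
Proof. by rewrite /window_sum big_cat !big_map. Qed.

Lemma bilateral_sum_window a x : bilateral_sum a x ->
  window_sum N a @[N --> \oo] --> x.
Proof.
move=> [x1 [x2 [c1 c2 ->]]].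
rewrite (_ : (fun N => window_sum N a) = fun N => series (fun n => a (Posz n)) N +
  series (fun n => a (Negz n)) N); last by apply/funext => N; rewrite window_sumE.
exact: cvgD c1 c2.
Qed.

Lemma window_sum_dist M N a g : (M <= N)%N -> (forall k, `|a k| <= g k) ->
  `|window_sum N a - window_sum M a| <= window_sum N g - window_sum M g.
Proof.
have split4 (x y z t : R) : x + y - (z + t) = (x - z) + (y - t) by ring.
move=> MN ag; rewrite !window_sumE !split4 !sub_series_geq//.
apply: (le_trans (ler_normD _ _)); apply: lerD;
  by apply: (le_trans (ler_norm_sum _ _ _)); apply: ler_sum.
Qed.

Lemma cvg_window_sum (F : nat -> int -> R) (l : int -> R) K :
  (forall k, F n k @[n --> \oo] --> l k) ->
  window_sum K (F n) @[n --> \oo] --> window_sum K l.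
Proof.
by move=> H; apply: (cvg_big (op := +%R)) => [|k _]; [exact: add_continuous|exact: H].
Qed.

Lemma window_sum_eventually (j : int) a : exists N0, forall N, (N0 <= N)%N ->
  window_sum N (fun k => a k * (k == j)%:R) = a j.
Proof.
exists `|j|.+1 => N jN; rewrite /window_sum.
have uN : uniq (int_window N).
  rewrite /int_window cat_uniq !map_inj_uniq ?iota_uniq//=; last 2 first.
  - by move=> x y [].
  - by move=> x y [].
  rewrite andbT; apply/hasPn => _ /mapP[n _ ->].
  by apply/mapP => -[].
have jin : j \in int_window N.
  rewrite /int_window mem_cat; apply/orP.
  case: j jN => n nN; [left|right]; apply: map_f; rewrite mem_index_iota/=.
    by rewrite absz_nat in nN; lia.
  by lia.
rewrite (bigD1_seq j)//= eqxx mulr1 big1 ?addr0// => k kj.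
by rewrite (negbTE kj) mulr0.
Qed.

Lemma ell2_bounded (d : int -> R) : ell2 d -> exists B, forall k, `|d k| <= B.
Proof.
rewrite /ell2 /summable; set E := (\esum_(k in _) _)%E => Eoo.
have E0 : (0 <= E)%E by apply: esum_ge0.
exists (fine E + 1) => k.
have : d k ^+ 2 <= fine E.
  rewrite -lee_fin fineK ?ge0_fin_numE//.
  apply: esum_ge; exists [set k]; first by split => //; exact: finite_set1.
  by rewrite fsbig_set1 /= lee_fin ler_norm.
rewrite -real_normK ?num_real//.
have := normr_ge0 (d k); move: (fine E) => y; move: (`|d k| : R) => x x0 h.
have := sqr_ge0 (x - 1); nra.
Qed.

Section Lorentz.
Variable s : R.
Hypothesis s0 : 0 < s.
Local Notation phi := (lorentz s).
Local Notation e := (nod_coef s).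

Let G (x : R) := x / (1 + `|x|).

Let G_bound x : `|G x| <= 1.
Proof.
have x0 : 0 < 1 + `|x| by rewrite ltr_pwDl.
by rewrite /G normrM normfV (gtr0_norm x0) ler_pdivrMr// mul1r lerDr.
Qed.

(** [x / (1 + |x|)] is bounded and increasing, and its increments between
    consecutive integers decay like [1 / x ^ 2], as [phi] does.  Summing gives a
    bound on sums of samples of [phi] that is uniform in the shift. *)
Lemma lorentz_le_telescope (j : int) :
  phi j%:~R <= 4 * (1 + s ^+ 2) * (G (j + 1)%:~R - G j%:~R).
Proof.
have main (x : R) : 0 <= x ->
    s ^+ 2 / (s ^+ 2 + x ^+ 2) <= 4 * (1 + s ^+ 2) * ((1 + x) * (2 + x))^-1.
  move=> x0; have s2 : 0 < s ^+ 2 by rewrite exprn_gt0.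
  have d0 : 0 < s ^+ 2 + x ^+ 2 by rewrite ltr_wpDr ?sqr_ge0.
  rewrite ler_pdivrMr// mulrAC ler_pdivlMr; last nra.
  have : (1 + x) * (2 + x) <= 4 * (1 + x ^+ 2) by nra.
  move: (s ^+ 2) s2 d0 => t t0 d0 H.
  apply: (@le_trans _ _ (t * (4 * (1 + x ^+ 2)))); first by rewrite ler_wpM2l// ltW.
  have : 0 <= x ^+ 2 by rewrite sqr_ge0.
  move: (x ^+ 2) => y y0; nra.
have nn (n : nat) : (0 : R) <= n%:R by [].
case: j => n.
  have -> : (Posz n + 1)%:~R = n%:R + 1 :> R by rewrite rmorphD.
  have -> : (Posz n)%:~R = n%:R :> R by [].
  rewrite /G /lorentz ger0_norm ?addr_ge0// ger0_norm//.
  apply: le_trans (main _ (nn n)) _; rewrite le_eqVlt; apply/orP; left; apply/eqP.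
  move: (n%:R) (nn n) => x x0; field.
  by apply/andP; split; rewrite gt_eqF//; lra.
have -> : (Negz n + 1)%:~R = - n%:R :> R.
  by rewrite NegzE -addn1 PoszD opprD addrNK mulrNz.
have -> : (Negz n)%:~R = - (n%:R + 1) :> R by rewrite NegzE mulrNz -pmulrn -natr1.
rewrite /G !normrN lorentz_even ger0_norm// ger0_norm ?addr_ge0//.
apply: (@le_trans _ _ (phi n%:R)).
  rewrite /lorentz ler_pM2l ?exprn_gt0// lef_pV2 ?posrE ?lorentz_den_gt0//.
  by rewrite lerD2l ler_pXn2r ?nnegrE ?addr_ge0// lerDl.
apply: le_trans (main _ (nn n)) _; rewrite le_eqVlt; apply/orP; left; apply/eqP.
move: (n%:R) (nn n) => x x0; field.
by apply/andP; split; rewrite gt_eqF//; lra.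
Qed.

Let L := 4 * (1 + s ^+ 2) * 2.

Lemma window_sum_lorentz_le K (i : int) :
  window_sum K (fun k => phi (i - k)%:~R) <= L.
Proof.
pose C := 4 * (1 + s ^+ 2).
have C0 : 0 <= C by rewrite mulr_ge0// addr_ge0// sqr_ge0.
suff : window_sum K (fun k => phi (i - k)%:~R) <=
    C * (G (i + Posz K + 1)%:~R - G (i - Posz K + 1)%:~R).
  move=> H; apply: (le_trans H); rewrite /L ler_wpM2l//.
  have := G_bound (i + Posz K + 1)%:~R; have := G_bound (i - Posz K + 1)%:~R.
  rewrite !ler_norml => /andP[h1 h2] /andP[h3 h4]; lra.
rewrite window_sumE; elim: K => [|K IH].
  have -> : i - Posz 0 + 1 = i + Posz 0 + 1 by lia.
  by rewrite /series/= !big_geq// addr0 subrr mulr0.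
rewrite !seriesSr.
have h1 := lorentz_le_telescope (i - Posz K).
have h2 := lorentz_le_telescope (i + Posz K + 1).
have e1 : i - Negz K = i + Posz K + 1 by rewrite NegzE; lia.
have e3 : i - Posz K.+1 + 1 = i - Posz K by lia.
rewrite e1 e3.
move: IH h1 h2; rewrite -/C; lra.
Qed.

(** Convolving once more with [nod_coef s], which inverts the samples of [phi],
    recovers [c].  The exchange of the two sums is made for the truncation of
    [nod_coef s] to a finite window; the error is controlled, uniformly in the
    truncation of the other sum, by the tail of the absolutely convergent
    series of [nod_coef s] and by [window_sum_lorentz_le]. *)
Lemma lorentz_convolution_injective (c : int -> R) (B : R) : (forall k, `|c k| <= B) ->
  (forall m : int, bilateral_sum (fun k => c k * phi (m - k)%:~R) 0) ->
  forall j, c j = 0.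
Proof.
move=> cB cphi j.
have B0 : 0 <= B by apply: le_trans (cB 0).
pose A N := window_sum N (fun k => `|e k|).
have Acvg : cvgn A.
  have v1 (k : int) : `|(fun=> 1 : R) k| <= 1 by rewrite normr1.
  have cp := @cvg_half_series R s _ _ _ sqr_Posz v1.
  have cn := @cvg_half_series R s _ _ _ sqr_Negz v1.
  apply/cvg_ex; exists (limn [normed series (fun n => e (Posz n) * 1)] +
    limn [normed series (fun n => e (Negz n) * 1)]).
  rewrite (_ : A = fun N => [normed series (fun n => e (Posz n) * 1)] N +
    [normed series (fun n => e (Negz n) * 1)] N).
    by apply: cvgD; [exact: cp|exact: cn].
  apply/funext => N; rewrite /A window_sumE.
  by congr (series _ _ + series _ _); apply/funext => n; rewrite /= mulr1.
have L0 : 0 <= L by rewrite /L !mulr_ge0// addr_ge0// sqr_ge0.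
have Aincr M N : (M <= N)%N -> A M <= A N.
  move=> MN; rewrite -subr_ge0.
  have := @window_sum_dist M N (fun k => `|e k|) (fun k => `|e k|) MN.
  by move=> H; apply: le_trans (H _) => // k; rewrite normr_id.
have AM M : A M <= limn A.
  by apply: limr_ge => //; near=> N; apply: Aincr; near: N; exact: nbhs_infty_ge.
(* The nod function interpolates the Kronecker delta, which makes [nod_coef s]
   a convolution inverse of the samples of [phi]. *)
have delta (i : int) : window_sum N (fun m => e m * phi (i - m)%:~R)
    @[N --> \oo] --> ((i == 0)%:R : R).
  have := bilateral_sum_window (@bilateral_nod_fun R s s0 i%:~R).
  rewrite nod_fun_int// (_ : (fun k => _) = fun m => e m * phi (i - m)%:~R)//.
  by apply/funext => k; rewrite rmorphB.
pose T M k := window_sum M (fun m => e m * phi (j - k - m)%:~R).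
have tail M K : window_sum K (fun k => `|(j - k == 0)%:R - T M k|) <= L * (limn A - A M).
  have cv : window_sum K (fun k => `|T N k - T M k|) @[N --> \oo] -->
      window_sum K (fun k => `|(j - k == 0)%:R - T M k|).
    apply: (@cvg_window_sum (fun N k => `|T N k - T M k|)) => k.
    apply: cvg_norm; apply: cvgB; [exact: delta|exact: cvg_cst].
  apply: (cvgr_to_le cv); near=> N.
  have MN : (M <= N)%N by near: N; exact: nbhs_infty_ge.
  apply: (@le_trans _ _ (L * (A N - A M))); last first.
    by rewrite ler_wpM2l// lerD2r.
  pose P m := window_sum K (fun k => phi (j - m - k)%:~R).
  have P0 m : 0 <= P m by apply: sumr_ge0 => k _; exact: lorentz_ge0.
  apply: (@le_trans _ _ (window_sum N (fun m => `|e m| * P m) -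
      window_sum M (fun m => `|e m| * P m))).
    have sw Q : window_sum Q (fun m => `|e m| * P m) =
        window_sum K (fun k => window_sum Q (fun m => `|e m| * phi (j - k - m)%:~R)).
      rewrite /window_sum exchange_big/=; apply: eq_bigr => m _.
      rewrite /P /window_sum mulr_sumr; apply: eq_bigr => k _.
      by congr (_ * phi _%:~R); lia.
    rewrite !sw /window_sum -sumrB; apply: ler_sum => k _.
    apply: window_sum_dist => // m.
    by rewrite normrM (ger0_norm (lorentz_ge0 s0 _)).
  have := @window_sum_dist M N (fun m => `|e m| * P m) (fun m => L * `|e m|) MN.
  have sL Q : window_sum Q (fun m => L * `|e m|) = L * A Q.
    by rewrite /A /window_sum mulr_sumr.
  rewrite !sL -mulrBr => H; apply: le_trans (ler_norm _) (H _) => m.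
  rewrite normrM normr_id (ger0_norm (P0 m)) mulrC ler_wpM2r//.
  exact: window_sum_lorentz_le.
have bound M : `|c j| <= B * (L * (limn A - A M)).
  (* Exchanging the finite sums exposes the convolutions of [c], which vanish. *)
  have X : window_sum K (fun k => c k * T M k) @[K --> \oo] --> (0 : R).
    rewrite (_ : (fun K => _) = fun K => window_sum M (fun m =>
      e m * window_sum K (fun k => c k * phi (j - m - k)%:~R))); last first.
      apply/funext => K; rewrite /T /window_sum.
      under eq_bigr do rewrite mulr_sumr.
      rewrite exchange_big/=; apply: eq_bigr => m _.
      rewrite mulr_sumr; apply: eq_bigr => k _.
      rewrite mulrCA; congr (_ * (_ * phi _%:~R)); lia.
    rewrite (_ : 0 = window_sum M (fun m => e m * 0)); last first.
      by rewrite /window_sum big1// => m _; rewrite mulr0.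
    apply: cvg_window_sum => m; apply: cvgM; first exact: cvg_cst.
    exact: bilateral_sum_window (cphi (j - m)).
  have Y : window_sum K (fun k => c k * (k == j)%:R) @[K --> \oo] --> c j.
    have [N0 HN] := window_sum_eventually j c.
    by apply: cvg_near_cst; exists N0 => // K /=; exact: HN.
  have Z : `|window_sum K (fun k => c k * (k == j)%:R) -
      window_sum K (fun k => c k * T M k)| @[K --> \oo] --> `|c j|.
    by apply: cvg_norm; rewrite -[X in _ --> X]subr0; apply: cvgB; [exact: Y|exact: X].
  apply: (cvgr_to_le Z); near=> K.
  rewrite /window_sum -sumrB.
  apply: (le_trans (ler_norm_sum _ _ _)).
  apply: (@le_trans _ _ (B * window_sum K (fun k => `|(j - k == 0)%:R - T M k|))).
    rewrite /window_sum mulr_sumr; apply: ler_sum => k _.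
    by rewrite -mulrBr normrM subr_eq0 [j == k]eq_sym ler_wpM2r.
  by rewrite ler_wpM2l// tail.
have Z : B * (L * (limn A - A M)) @[M --> \oo] --> (0 : R).
  rewrite -[X in _ --> X](mulr0 B); apply: cvgM; first exact: cvg_cst.
  rewrite -[X in _ --> X](mulr0 L); apply: cvgM; first exact: cvg_cst.
  by rewrite -[X in _ --> X](subrr (limn A)); apply: cvgB; [exact: cvg_cst|exact: Acvg].
apply/eqP; rewrite -normr_le0.
by apply: (cvgr_to_ge Z); apply: nearW.
Unshelve. all: by end_near. Qed.

End Lorentz.
End Uniqueness.

(** * Uniqueness of the nod function and its distance to sinc *)

Section Final.
Context {R : realType}.
Notation mu := (@lebesgue_measure R).
Variable s : R.
Hypothesis s0 : 0 < s.
Local Notation phi := (lorentz s).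
Local Notation S := (inv_symbol_per s).

Lemma bilateral_sumB (a b : int -> R) x y : bilateral_sum a x -> bilateral_sum b y ->
  bilateral_sum (fun k => a k - b k) (x - y).
Proof.
move=> [x1 [x2 [cx1 cx2 ->]]] [y1 [y2 [cy1 cy2 ->]]].
have sB (u v : nat -> R) : series (fun n => u n - v n) = (fun n => series u n - series v n).
  by apply/funext => n; rewrite /series/= sumrB.
exists (x1 - y1), (x2 - y2); split; last by ring.
- by rewrite sB; exact: cvgB cx1 cy1.
- by rewrite sB; exact: cvgB cx2 cy2.
Qed.

(** The difference of the coefficients is bounded and its convolution with the
    samples of [phi] is 0, since both functions take the same values at the
    integers. *)
Lemma basic_nod_function_unique (f : R -> R) :
  basic_nod_function phi f -> f = nod_fun s.
Proof.
move=> [[d d2 fd] fm].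
pose c k := d k - nod_coef s k.
have [B dB] := ell2_bounded d2.
have [C eC] := nod_coef_bound s.
have cBC k : `|c k| <= B + C.
  by apply: (le_trans (ler_normB _ _)); apply: lerD.
have ccv t : bilateral_sum (fun k => c k * phi (t - k%:~R)) (f t - nod_fun s t).
  have := bilateral_sumB (fd t) (bilateral_nod_fun s0 t).
  by congr bilateral_sum; apply/funext => k; rewrite -mulrBl.
have c0 : forall k, c k = 0.
  apply: (lorentz_convolution_injective s0 cBC) => m.
  have := ccv m%:~R; rewrite fm nod_fun_int// subrr.
  by congr bilateral_sum; apply/funext => k; rewrite rmorphB.
apply/funext => t; apply/eqP; rewrite -subr_eq0; apply/eqP.
have /(cvg_lim (@Rhausdorff R)) <- := bilateral_sum_window (ccv t).
apply/cvg_lim => //; apply: cvg_near_cst; apply: nearW => N.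
by rewrite /window_sum big1// => k _; rewrite c0 mul0r.
Qed.

Definition band : set (measurableTypeR R) := `[- pi, pi]%classic.

(** Density of [nod_fun s t - sinc (pi * t)]. *)
Definition spectral_error (w : R) : R :=
  s / 2 * expR (- (s * `|w|)) * S w - ((fun=> (2 * pi)^-1) \_ band) w.

Lemma sincE t : sinc (pi * t) = \int[mu]_w (((fun=> (2 * pi)^-1) \_ band) w * cos (w * t)).
Proof.
have p0 := pi_gt0 R.
transitivity (\int[mu]_(w in `[- pi, pi]) ((2 * pi)^-1 * cos (w * t))); last first.
  rewrite Rintegral_mkcond; apply: eq_Rintegral => w _.
  by rewrite /patch -/band; case: ifP => _; rewrite ?mul0r.
have pp : - pi <= pi :> R by lra.
rewrite /sinc mulf_eq0 gt_eqF//=.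
have cc : continuous (fun w : R => (2 * pi)^-1 * cos (w * t)).
  by apply: continuousM_fun; [exact: continuous_cst_fun|exact: continuous_cosM].
case: eqP => [t0|/eqP t0].
  have dF (w : R) : is_derive w 1 (fun w => (2 * pi)^-1 * w) ((2 * pi)^-1 * cos (w * t)).
    by rewrite t0 mulr0 cos0; apply: is_derive_eq; rewrite /GRing.scale/=; ring.
  rewrite (Rintegral_FTC pp cc dF); move: pi p0 => p p0.
  by field; rewrite gt_eqF.
have dF (w : R) : is_derive w 1 (fun w => (2 * pi)^-1 * (sin (w * t) / t)) ((2 * pi)^-1 * cos (w * t)).
  apply: is_derive_eq; rewrite /GRing.scale/=; move: pi p0 => p p0.
  by field; rewrite t0 gt_eqF.
rewrite (Rintegral_FTC pp cc dF) mulNr sinN; move: (sin _) => x.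
by move: pi p0 => p p0; field; rewrite t0 gt_eqF.
Qed.

Lemma measurable_band : measurable band. Proof. exact: measurable_itv. Qed.

Lemma integrable_band : mu.-integrable setT (EFin \o ((fun=> (2 * pi)^-1) \_ band)).
Proof.
have := @continuous_integrable_itv R (- pi) pi _ (@continuous_cst_fun R (2 * pi)^-1).
rewrite (integrable_mkcond _ measurable_band).
by rewrite restrict_EFin.
Qed.

Lemma integrable_main : mu.-integrable setT
  (EFin \o (fun w => s / 2 * expR (- (s * `|w|)) * S w)).
Proof.
apply: (@integrable_mul_bounded _ _ _ _ (twice_sinh s 0 / (2 * pi * s))) => //.
- have := integrableZl measurableT (s / 2) (integrable_expRN_norm s0).
  by apply: eq_integrable => // w _ /=; rewrite EFinM.
- by apply: continuous_measurable_fun; exact: continuous_inv_symbol_per.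
- move=> w _; have /andP[h1 h2] := inv_symbol_per_bound s0 w.
  by rewrite ger0_norm.
Qed.

Lemma integrable_spectral_error : mu.-integrable setT (EFin \o spectral_error).
Proof.
have := integrableB measurableT integrable_main integrable_band.
by apply: eq_integrable => // w _ /=; rewrite -EFinB.
Qed.

Lemma nod_fun_sub_sincE t :
  nod_fun s t - sinc (pi * t) = cos_transform spectral_error t.
Proof.
have mc : measurable_fun [set: measurableTypeR R] (fun w : R => cos (w * t)).
  by apply: continuous_measurable_fun; exact: continuous_cosM.
have c1 (w : measurableTypeR R) : [set: measurableTypeR R] w -> `|cos (w * t)| <= 1.
  by move=> _; exact: cos_max.
have i1 := integrable_mul_bounded measurableT integrable_main mc c1.
have i2 := integrable_mul_bounded measurableT integrable_band mc c1.
rewrite sincE /cos_transform /spectral_error.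
transitivity (\int[mu]_w (s / 2 * expR (- (s * `|w|)) * S w * cos (w * t)) -
  \int[mu]_w (((fun=> (2 * pi)^-1) \_ band) w * cos (w * t))).
  by congr (_ - _); apply: eq_Rintegral => w _; rewrite /nod_density; ring.
rewrite -RintegralB//.
by apply: eq_Rintegral => w _; ring.
Qed.

(** For [|w| <= pi] the density of the nod function is [1 / (2 pi)] times
    [(exp (s (pi - |w|)) - exp (- s (pi + |w|))) / (2 cosh (s (pi - |w|)))], which
    falls short of [1 / (2 pi)] by an amount of order [exp (- s (pi - |w|))].
    Outside the band, the bound on [inv_symbol_per] leaves
    at most [exp (- s (|w| - pi)) / (4 pi)]. *)
Lemma spectral_error_le w :
  `|spectral_error w| <= (2 * pi)^-1 * expR (- (s * `| `|w| - pi |)).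
Proof.
have p0 := pi_gt0 R; have N0 := twice_sinh0_gt0 s0.
have SwE : S w = S `|w|.
  by case: (leP 0 w) => w0; [rewrite ger0_norm|rewrite ltr0_norm ?inv_symbol_per_even].
rewrite /spectral_error SwE /patch.
have -> : (w \in band) = (`|w| <= pi).
  by apply/idP/idP; rewrite /band inE/= in_itv/= ler_norml.
set a := `|w|; have a0 : 0 <= a by exact: normr_ge0.
case: ifPn => [ap|].
  rewrite inv_symbol_perE ?a0// /inv_symbol (distrC a pi) [`|pi - a|]ger0_norm ?subr_ge0//.
  set u := expR (- (s * (pi - a))); have u0 : 0 < u by exact: expR_gt0.
  have uV : u^-1 = expR (s * (pi - a)) by rewrite /u expRN invrK.
  have chE : twice_cosh s a = u^-1 + u by rewrite /twice_cosh -/u uV.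
  pose v := expR (- (s * (pi + a))).
  have vu : v <= u.
    by rewrite ler_expR lerN2 ler_pM2l// lerD2l; lra.
  have v0 : 0 < v by exact: expR_gt0.
  have eN : expR (- (s * a)) * twice_sinh s 0 = u^-1 - v.
    rewrite /twice_sinh subr0 mulrBr -!expRD uV; congr (expR _ - expR _); ring.
  have ch2 := twice_cosh_ge2 s a; have c0 := twice_cosh_gt0 s a.
  have -> : s / 2 * expR (- (s * a)) * (twice_sinh s 0 / (pi * s) / twice_cosh s a) - (2 * pi)^-1 =
      - ((2 * pi)^-1 * ((v + u) / twice_cosh s a)).
    rewrite (_ : _ * (_ / _) = (2 * pi)^-1 * (expR (- (s * a)) * twice_sinh s 0 / twice_cosh s a)); last first.
      by move: pi p0 => p pp; field; rewrite !gt_eqF.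
    rewrite eN chE; rewrite chE in c0; move: pi p0 => p pp; field.
    rewrite !gt_eqF//=.
    by rewrite addr_gt0 ?mulr_gt0.
  rewrite normrN ger0_norm; last first.
    apply: mulr_ge0; first by rewrite invr_ge0 mulr_ge0// ltW.
    by apply: divr_ge0; [apply: addr_ge0; exact: ltW|exact: ltW].
  rewrite ler_pM2l ?invr_gt0 ?mulr_gt0// ler_pdivrMr//.
  nra.
rewrite -ltNge => pa.
have /andP[S0 SN] := inv_symbol_per_bound s0 a.
rewrite subr0 ger0_norm; last by rewrite mulr_ge0// mulr_ge0 ?expR_ge0// divr_ge0// ltW.
rewrite ger0_norm; last by rewrite subr_ge0 ltW.
apply: (@le_trans _ _ (s / 2 * expR (- (s * a)) * (twice_sinh s 0 / (2 * pi * s)))).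
  by rewrite ler_wpM2l// mulr_ge0 ?expR_ge0// divr_ge0// ltW.
rewrite (_ : _ * (_ / _) = (2 * pi)^-1 * (expR (- (s * a)) * twice_sinh s 0 / 2)); last first.
  by move: pi p0 => p pp; field; rewrite !gt_eqF.
rewrite ler_pM2l ?invr_gt0 ?mulr_gt0// /twice_sinh subr0 mulrBr -!expRD.
rewrite (_ : - (s * a) + s * pi = - (s * (a - pi))); last by ring.
have := expR_gt0 (- (s * (a - pi))); have := expR_gt0 (- (s * a) + - (s * pi)).
lra.
Qed.

(** This trades the exponential for a Poisson kernel, whose integral is at
    hand. *)
Lemma expRN_sqr_le (x : R) : 0 <= x -> expR (- x) ^+ 2 <= (1 + x ^+ 2)^-1.
Proof.
move=> x0; have h := expR_ge1Dx x.
rewrite expRN exprVn lef_pV2 ?posrE ?exprn_gt0 ?expR_gt0//; last first.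
  by rewrite ltr_wpDr ?sqr_ge0.
apply: (@le_trans _ _ ((1 + x) ^+ 2)); first by nra.
by rewrite ler_pXn2r ?nnegrE ?addr_ge0 ?expR_ge0.
Qed.

Let cauchy (x : R) := s^-1 / (s^-1 ^+ 2 + x ^+ 2).

Let cauchyE x : (1 + (s * x) ^+ 2)^-1 = s^-1 * cauchy x.
Proof.
rewrite /cauchy; have h : 0 < 1 + (s * x) ^+ 2 by rewrite ltr_wpDr ?sqr_ge0.
have -> : s^-1 ^+ 2 + x ^+ 2 = (1 + (s * x) ^+ 2) / s ^+ 2.
  by field; rewrite gt_eqF.
by field; rewrite !gt_eqF//.
Qed.

Let cauchy_ge0 x : 0 <= cauchy x.
Proof.
have si : 0 < s^-1 by rewrite invr_gt0.
by rewrite divr_ge0 ?addr_ge0 ?sqr_ge0// ltW.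
Qed.

Lemma spectral_error_sqr_le w : spectral_error w ^+ 2 <=
  (2 * pi)^-1 ^+ 2 * s^-1 * (cauchy (- pi + w) + cauchy (pi + w)).
Proof.
have p0 := pi_gt0 R.
rewrite -real_normK ?num_real//.
apply: (@le_trans _ _ (((2 * pi)^-1 * expR (- (s * `| `|w| - pi |))) ^+ 2)).
  rewrite ler_pXn2r ?nnegrE ?spectral_error_le//.
  by rewrite mulr_ge0 ?expR_ge0// invr_ge0 mulr_ge0// ltW.
rewrite exprMn -mulrA ler_wpM2l ?sqr_ge0//.
apply: (le_trans (expRN_sqr_le _)); first by rewrite mulr_ge0// ltW.
rewrite exprMn real_normK ?num_real// -exprMn cauchyE.
rewrite ler_pM2l ?invr_gt0//.
have [w0|w0] := leP 0 w.
  by rewrite ger0_norm// addrC lerDl cauchy_ge0.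
rewrite ltr0_norm// (_ : cauchy (- w - pi) = cauchy (pi + w)) ?lerDr ?cauchy_ge0//.
by rewrite /cauchy; congr (_ / (_ + _)); ring.
Qed.

Lemma integral_spectral_error_sqr :
  (\int[mu]_w (spectral_error w ^+ 2)%:E <= ((2 * pi * s)^-1)%:E)%E.
Proof.
have p0 := pi_gt0 R; have si : 0 < s^-1 by rewrite invr_gt0.
set c := (2 * pi)^-1 ^+ 2 * s^-1.
have c0 : 0 <= c by rewrite mulr_ge0 ?sqr_ge0// ltW.
have mc d : measurable_fun [set: measurableTypeR R] (fun w => (cauchy (d + w))%:E).
  apply/measurable_EFinP; apply: continuous_measurable_fun => x.
  apply: cvgM; first exact: cvg_cst.
  apply: cvgV; first by rewrite gt_eqF// ltr_wpDr ?sqr_ge0 ?exprn_gt0.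
  apply: cvgD; first exact: cvg_cst.
  have cx : (d + y) @[y --> x] --> d + x by apply: cvgD; [exact: cvg_cst|].
  exact: (cvgM cx cx).
have mD : measurable_fun [set: measurableTypeR R]
    (fun w => (cauchy (- pi + w))%:E + (cauchy (pi + w))%:E)%E.
  exact: emeasurable_funD.
apply: (@le_trans _ _ (\int[mu]_w (c%:E * ((cauchy (- pi + w))%:E + (cauchy (pi + w))%:E)))%E).
  apply: ge0_le_integral => //.
  - by move=> w _; rewrite lee_fin sqr_ge0.
  - apply/measurable_EFinP; apply: measurable_funX; apply/measurable_EFinP.
    exact: measurable_int integrable_spectral_error.
  - exact: emeasurable_funM.
  - by move=> w _; rewrite -EFinD -EFinM lee_fin spectral_error_sqr_le.
rewrite ge0_integralZl//; last by move=> w _; rewrite adde_ge0 ?lee_fin ?cauchy_ge0.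
rewrite ge0_integralD//; last 2 first.
- by move=> w _; rewrite lee_fin cauchy_ge0.
- by move=> w _; rewrite lee_fin cauchy_ge0.
rewrite !ge0_integral_poisson// -EFinD -EFinM lee_fin le_eqVlt; apply/orP; left.
by apply/eqP; rewrite /c; move: pi p0 => p pp; field; rewrite !gt_eqF.
Qed.

(** The rate [1 / s] is the product of Plancherel's constant [2 pi] and of
    [integral_spectral_error_sqr]. *)
Lemma nod_fun_L2_dist :
  (\int[mu]_t (`|nod_fun s t - sinc (pi * t)| ^+ 2)%:E <= (s^-1)%:E)%E.
Proof.
have p0 := pi_gt0 R.
under eq_integral do rewrite real_normK ?num_real// nod_fun_sub_sincE.
apply: (le_trans (cos_transform_L2_le integrable_spectral_error)).
have p2 : (0 <= (2 * pi)%:E :> \bar R)%E by rewrite lee_fin mulr_ge0// ltW.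
apply: (le_trans (lee_wpmul2l p2 integral_spectral_error_sqr)).
rewrite -EFinM lee_fin le_eqVlt; apply/orP; left; apply/eqP.
by move: pi p0 => p pp; field; rewrite !gt_eqF.
Qed.

End Final.

Unset Implicit Arguments.

Theorem theorem4 (R : realType) :
  (forall s : R, 0 < s ->
     exists! f : R -> R, basic_nod_function (lorentz s) f) /\
  (forall nod : R -> R -> R,
     (forall s : R, 0 < s -> basic_nod_function (lorentz s) (nod s)) ->
     (\int[@lebesgue_measure R]_t (`|nod s t - sinc (pi * t)| ^+ 2)%:E)%E
       @[s --> +oo] --> 0%E).
Proof.
split=> [s s0|nod nodP].
  exists (nod_fun s); split; first exact: basic_nod_function_nod_fun.
  by move=> f /(basic_nod_function_unique s0).
have inv_cvg0 : (s^-1)%:E @[s --> +oo] --> (0%E : \bar R).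
  apply: cvg_EFin; first exact: nearW.
  apply/cvgrPdist_lt => e e0; near=> s.
  have s0 : 0 < s by near: s; apply: nbhs_pinfty_gt; exact: num_real.
  rewrite sub0r normrN /= gtr0_norm ?invr_gt0// -[e]invrK ltf_pV2 ?posrE ?invr_gt0//.
  by near: s; apply: nbhs_pinfty_gt; exact: num_real.
apply: (squeeze_cvge _ (cvg_cst 0%E) inv_cvg0); near=> s.
have s0 : 0 < s by near: s; apply: nbhs_pinfty_gt; exact: num_real.
apply/andP; split; first by apply: integral_ge0 => t _; rewrite lee_fin exprn_ge0.
rewrite (basic_nod_function_unique s0 (nodP s s0)).
exact: nod_fun_L2_dist.
Unshelve. all: by end_near. Qed.
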